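(* Let $c,\varepsilon>0$ be constants. Then there exists a constant $c_2=c_2(\varepsilon,c)\ge 1/96$ such that for all integers $t\ge3$ and $\lambda\ge1$ with $(\lambda t)^{2\varepsilon}(\log\lambda t)^{1-\varepsilon}\le ct^2$, $$\frac{\lambda t^2}{96\log(\lambda t)}\le R(B_\lambda,K^3_t)\le\frac{c_2\lambda t^2}{\log(\lambda t)}.$$
   Context: A $3$-graph is a $3$-uniform hypergraph. $K^3_t$ is the complete $3$-graph on $t$ vertices. $B_\lambda=K_3^3(1,1,\lambda+1)$ is the $3$-graph on vertex set $\{x,y,z_1,\dots,z_{\lambda+1}\}$ with edges $xyz_i$ for $1\le i\le\lambda+1$. The Ramsey number $R(S,T)$ of $3$-graphs $S$ and $T$ is the minimum integer $N$ such that every colouring of the edges of $K_N^3$ with red and blue yields a red copy of $S$ or a blue copy of $T$. $\log$ denotes the natural logarithm. *)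

(* Defs.v *)
From HB Require Import structures.
From mathcomp Require Import all_boot all_order all_algebra.
From mathcomp Require Import all_classical all_reals all_analysis.

Set Implicit Arguments.
Unset Strict Implicit.
Unset Printing Implicit Defensive.

Record graph3 := Graph3 {
  vertex : finType;
  edges : {set {set vertex}};
  card_edge : forall e, e \in edges -> #|e| = 3
}.

Lemma card_complete3_edge n (e : {set 'I_n}) :
  e \in [set e : {set 'I_n} | #|e| == 3] -> #|e| = 3.
Proof. by rewrite inE => /eqP. Qed.

Definition complete3 (n : nat) : graph3 := Graph3 (@card_complete3_edge n).

(* The vertices x, y are the two elements of the left summand 'I_2,
   and the z_i those of the right summand. *)
Definition book_edge (lambda : nat) (i : 'I_lambda.+1) :
    {set 'I_2 + 'I_lambda.+1} :=
  [set inl ord0; inl ord_max; inr i].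

Lemma card_book_edge lambda (e : {set 'I_2 + 'I_lambda.+1}) :
  e \in [set book_edge i | i : 'I_lambda.+1] -> #|e| = 3.
Proof.
by move=> /imsetP[i _ ->]; rewrite /book_edge finset.setUC cardsU1 cards2 !inE.
Qed.

Definition book3 (lambda : nat) : graph3 := Graph3 (@card_book_edge lambda).

Definition has_copy (S G : graph3) : Prop :=
  exists f : vertex S -> vertex G,
    injective f /\ forall e : {set vertex S}, e \in edges S -> f @: e \in edges G.

Lemma card_colour_class_edge n (chi : {set 'I_n} -> bool) (b : bool) e :
  e \in [set e in edges (complete3 n) | chi e == b] -> #|e| = 3.
Proof. by rewrite inE => /andP[/card_edge]. Qed.

Definition colour_class n (chi : {set 'I_n} -> bool) (b : bool) : graph3 :=
  Graph3 (@card_colour_class_edge n chi b).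

(* chi colours the edges of complete3 N, true for red and false for blue; its
   values on sets of cardinality other than 3 are irrelevant. *)
Definition ramsey_arrow (N : nat) (S T : graph3) : Prop :=
  forall chi : {set 'I_N} -> bool,
    has_copy S (colour_class chi true) \/ has_copy T (colour_class chi false).

Definition is_ramsey_number (S T : graph3) (N : nat) : Prop :=
  ramsey_arrow N S T /\ forall M : nat, ramsey_arrow M S T -> M >= N.

(* Main.v *)
Require Import Defs.
From HB Require Import structures.
From mathcomp Require Import all_boot all_order all_algebra.
From mathcomp Require Import all_classical all_reals all_analysis.
From mathcomp Require Import fintype finset ring lra zify.
Import Order.TTheory GRing.Theory Num.Theory.
Local Open Scope ring_scope.
Set Implicit Arguments.
Unset Strict Implicit.
Unset Printing Implicit Defensive.

(** Write L for ln (lambda * t), and call the codegree of a pair of vertices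
    the number of red triples that contain it.  A colouring of the triples of
    n vertices avoids the book and the blue clique exactly when every red
    codegree is at most lambda and every t-set contains a red triple
    ([book_copyP], [complete_copyP]).  So the Ramsey number measures how small
    the independence number of a triple system of codegree at most lambda on
    n vertices can be.

    Lower bound.  Suppose n < lambda t^2 / (96 L).  Take a random triple
    system G of density p = 96 L / (7 t^2), and H maximal among the subsystems
    of G of codegree at most lambda.  If a t-set S is independent in H, then by
    maximality every triple of G inside S contains a pair that already lies in
    lambda triples of H, and these leave S because S is independent
    ([maximal_triple_system]).  Whether a pair of S is crowded in this way
    depends only on triples that meet S in exactly that pair.  Hence different
    pairs are crowded independently of each other and of the triples inside S.
    Few pairs are crowded, so that most triples inside S must be absent from G;
    this has probability at most e^{- L t} ([expect_blocked]), which beats the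
    number of t-sets ([sparse_weight_lt1], [exists_triple_system]).

    Upper bound.  Put m = n / lambda.  A triple system of codegree at most
    lambda has an independent set of order sqrt (m ln m).  This follows the
    random independent set method of Shearer and Alon.  Let U be a random
    vertex set of density m^{-9/20} / lambda, and W a uniformly random
    independent subset of U.  For a vertex v outside U, compare the proportion
    of the W that stay independent when v is added with the mean number of
    pairs P inside W such that P and v form a triple.  The sample is so thin
    that around most v these pairs are disjoint and W can be resampled freely
    on them.  If y of them are available, then W contains none with
    probability (3/4)^y and contains y/4 of them on average, so that the two
    quantities cannot both be small ([link_tradeoff]).  If all independent sets
    have at most t vertices, then the sum over v of the first one is bounded
    through the number of vertices of W ([sum_extension_ratio]), and that of
    the second by lambda t^2 / 2, since each pair inside W has codegree at most
    lambda ([sum_mean_links]).  Averaging over U gives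
    t^2 >= (3/800) m ln m for large m ([independence_number_bound]).  The hypothesis of the
    theorem yields t^2 / L >= e^{eps L} / c ([expR_mul_ln_le]); so for n of
    order c2 lambda t^2 / L with c2 large, ln m is at least eps L, and
    m ln m exceeds t^2 by a factor of order eps c2. *)

(** * Random subsets with independent elements *)
Section ProductMeasure.
Variables (R : comNzRingType) (T : finType) (p : T -> R).
Implicit Types (A U : {set T}) (F : {set T} -> R).

(** The elements may have different probabilities: a constant [p] gives random
    triple systems and random vertex samples, and values 1/2 and 0 give the
    uniform law on the subsets of a fixed set. *)
Definition bernw A : R := \prod_i (if i \in A then p i else 1 - p i).
Definition expect F : R := \sum_A bernw A * F A.

Lemma expect1 : expect (fun=> 1) = 1.
Proof.
rewrite /expect /bernw; under eq_bigr do rewrite mulr1.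
by rewrite -(bigA_distr _ _ p (fun i => 1 - p i)) big1 // => i _ /=; ring.
Qed.

Lemma eq_expect F G : F =1 G -> expect F = expect G.
Proof. by move=> FG; apply: eq_bigr => A _; rewrite FG. Qed.

Lemma expect_sum I (r : seq I) (P : pred I) (F : I -> {set T} -> R) :
  expect (fun U => \sum_(i <- r | P i) F i U) = \sum_(i <- r | P i) expect (F i).
Proof.
by rewrite /expect exchange_big; apply: eq_bigr => A _; rewrite big_distrr.
Qed.

Lemma expectD F G : expect (fun U => F U + G U) = expect F + expect G.
Proof. by rewrite -big_split; apply: eq_bigr => A _; rewrite mulrDr. Qed.

Lemma expectZ c F : expect (fun U => c * F U) = c * expect F.
Proof. by rewrite mulr_sumr; apply: eq_bigr => A _; rewrite mulrCA. Qed.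

Lemma expect_cst c : expect (fun=> c) = c.
Proof.
by rewrite -[RHS]mulr1 -expect1 -expectZ; apply: eq_expect => A; rewrite mulr1.
Qed.

Lemma expect_sub A : expect (fun U => (A \subset U)%:R) = \prod_(i in A) p i.
Proof.
pose q i := if i \in A then 0 else 1 - p i.
have -> : \prod_(i in A) p i = \prod_i (p i + q i).
  rewrite [LHS]big_mkcond; apply: eq_bigr => i _; rewrite /q.
  by case: ifP => _; ring.
rewrite bigA_distr; apply: eq_bigr => U _.
case: (boolP (A \subset U)) => [AU|/subsetPn[i iA iU]].
  rewrite mulr1; apply: eq_bigr => i _; case: ifP => // /negbT iU.
  by rewrite /q ifN //; apply: contra iU; exact: (subsetP AU).
by rewrite /= mulr0 (bigD1 i) //= (negbTE iU) /q iA mul0r.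
Qed.

Lemma expect_disjoint A :
  expect (fun U => [disjoint A & U]%:R) = \prod_(i in A) (1 - p i).
Proof.
pose q i := if i \in A then 0 else p i.
have -> : \prod_(i in A) (1 - p i) = \prod_i (q i + (1 - p i)).
  rewrite [LHS]big_mkcond; apply: eq_bigr => i _; rewrite /q.
  by case: ifP => _; ring.
rewrite bigA_distr; apply: eq_bigr => U _.
case: (boolP [disjoint A & U]) => [AU|/pred0Pn[i /andP[/= iA iU]]].
  rewrite mulr1; apply: eq_bigr => i _; case: ifP => // iU.
  by rewrite /q ifN //; apply: contraTN iU => iA; rewrite (disjointFr AU).
by rewrite /= mulr0 (bigD1 i) //= iU /q iA mul0r.
Qed.

(** Two independent copies may exchange their traces on [A]: this involution
    preserves the product of the two weights. *)
Lemma expect_resample A (Phi : {set T} -> {set T} -> R) :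
  expect (fun U => Phi (U :&: A) (U :\: A))
  = expect (fun V => expect (fun U => Phi (U :&: A) (V :\: A))).
Proof.
pose mix U V := (U :&: A) :|: (V :\: A).
have mixI U V : mix U V :&: A = U :&: A.
  by apply/setP => i; rewrite !inE; do !case: (i \in _).
have mixD U V : mix U V :\: A = V :\: A.
  by apply/setP => i; rewrite !inE; do !case: (i \in _).
have mixK U V : mix (mix U V) (mix V U) = U.
  by apply/setP => i; rewrite !inE; do !case: (i \in _).
have bernw_mix U V : bernw (mix U V) * bernw (mix V U) = bernw U * bernw V.
  rewrite -!big_split; apply: eq_bigr => i _ /=; rewrite !inE.
  by do !case: (i \in _) => //=; rewrite mulrC.
pose sw (x : {set T} * {set T}) := (mix x.1 x.2, mix x.2 x.1).
have swK : involutive sw by case=> U V; rewrite /sw /= !mixK.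
transitivity (\sum_(x : {set T} * {set T})
    bernw x.1 * bernw x.2 * Phi (x.2 :&: A) (x.1 :\: A)); last first.
  rewrite -(pair_bigA _ (fun V U => bernw V * bernw U * Phi (U :&: A) (V :\: A))).
  apply: eq_bigr => V _ /=; rewrite mulr_sumr.
  by apply: eq_bigr => U _; rewrite mulrA.
rewrite (reindex_inj (inv_inj swK)) /=.
under eq_bigr => x _ do rewrite bernw_mix mixI mixD.
rewrite -(pair_bigA _ (fun V U => bernw V * bernw U * Phi (U :&: A) (U :\: A))) /=.
rewrite -[LHS]mul1r -expect1 mulr_suml.
apply: eq_bigr => V _; rewrite mulr1 mulr_sumr.
by apply: eq_bigr => U _; rewrite mulrA.
Qed.

Definition depends_on A F := forall U, F U = F (U :&: A).

Lemma depends_onW A (B : {set T}) F : A \subset B -> depends_on A F -> depends_on B F.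
Proof.
by move=> AB FA U; rewrite FA [RHS]FA -finset.setIA (setIidPr AB).
Qed.

Lemma expectM A (B : {set T}) F G : [disjoint A & B] -> depends_on A F -> depends_on B G ->
  expect (fun U => F U * G U) = expect F * expect G.
Proof.
move=> AB FA GB.
have GA U : G U = G (U :\: A).
  rewrite GB [RHS]GB; congr G; apply/setP => i; rewrite !inE.
  by case: (boolP (i \in A)) => // iA; rewrite (disjointFr AB iA) !andbF.
under eq_expect => U do rewrite FA GA.
rewrite (expect_resample A (fun X Y => F X * G Y)) mulrC -expectZ.
transitivity (expect (fun V => G (V :\: A) * expect F)).
  apply: eq_expect => V; rewrite -expectZ; apply: eq_expect => U.
  by rewrite -FA mulrC.
by rewrite expectZ; under eq_expect => V do rewrite -GA mulrC; rewrite expectZ mulrC.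
Qed.

Lemma expect_prod (I : eqType) (r : seq I) (B : I -> {set T})
    (F : I -> {set T} -> R) :
    uniq r -> {in r &, forall i j, i != j -> [disjoint B i & B j]} ->
    (forall i, depends_on (B i) (F i)) ->
  expect (fun U => \prod_(i <- r) F i U) = \prod_(i <- r) expect (F i).
Proof.
elim: r => [|i r IHr] /=.
  by move=> _ _ _; rewrite big_nil; under eq_expect do rewrite big_nil; exact: expect1.
case/andP=> ir ur disjB FB; rewrite big_cons -IHr //; last first.
  by move=> j k jr kr; apply: disjB; rewrite inE ?jr ?kr orbT.
under eq_expect do rewrite big_cons.
pose C := [set x | has (fun j => x \in B j) r].
apply: (@expectM (B i) C) => //.
  rewrite disjoint_subset; apply/subsetP => x xi; rewrite !inE; apply/hasPn => j jr.
  have/disjointFr->//: [disjoint B i & B j].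
  by apply: disjB; rewrite ?inE ?eqxx ?jr ?orbT //; apply: contraNneq ir => ->.
move=> U; rewrite [LHS]big_seq [RHS]big_seq; apply: eq_bigr => j jr.
apply: depends_onW (FB j) U; apply/subsetP => x xj; rewrite inE.
by apply/hasP; exists j.
Qed.

End ProductMeasure.

Section ProductMeasureOrder.
Variables (R : realDomainType) (T : finType) (p : T -> R).
Hypothesis p01 : forall i, 0 <= p i <= 1.

Lemma bernw_ge0 A : 0 <= bernw p A.
Proof.
by apply: prodr_ge0 => i _; have/andP[p0 p1] := p01 i; case: ifP; rewrite ?subr_ge0.
Qed.

Lemma le_expect F G : (forall U, F U <= G U) -> expect p F <= expect p G.
Proof. by move=> FG; apply: ler_sum => U _; rewrite ler_wpM2l ?bernw_ge0. Qed.

Lemma expect_lt1 F : expect p F < 1 -> exists U, F U < 1.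
Proof.
move=> ltF; apply/existsP; apply: contraTT ltF; rewrite negb_exists -leNgt => /forallP FU.
by rewrite -(expect1 p); apply: le_expect => U; rewrite leNgt.
Qed.

End ProductMeasureOrder.

(** * Colourings as triple systems of bounded codegree *)
Definition triples (V : finType) : {set {set V}} := [set e : {set V} | #|e| == 3%N].

Section TripleSystems.
Variable V : finType.
Implicit Types (H : {set {set V}}) (P W : {set V}).

Definition nbr H P := [set z | (z \notin P) && (z |: P \in H)].

Definition indep H W := [forall e in H, ~~ (e \subset W)].

Definition codeg_le lambda H := [forall P : {set V}, (#|P| == 2%N) ==> (#|nbr H P| <= lambda)%N].

Lemma indepP H W : reflect (forall e, e \in H -> ~~ (e \subset W)) (indep H W).
Proof. exact: forall_inP. Qed.

Lemma indepS H W W' : W \subset W' -> indep H W' -> indep H W.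
Proof.
move=> sub /indepP ind; apply/indepP => e /ind; apply: contraNN => eW.
exact: subset_trans eW sub.
Qed.

Lemma codeg_leP lambda H :
  reflect (forall P : {set V}, #|P| = 2%N -> (#|nbr H P| <= lambda)%N) (codeg_le lambda H).
Proof.
apply: (iffP forallP) => [h P P2|h P]; first by have := h P; rewrite P2 eqxx.
by apply/implyP => /eqP; exact: h.
Qed.

End TripleSystems.

Definition red n (chi : {set 'I_n} -> bool) : {set {set 'I_n}} :=
  [set e in triples 'I_n | chi e].

Lemma red_triples n (chi : {set 'I_n} -> bool) : red chi \subset triples 'I_n.
Proof. by apply/subsetP => e; rewrite inE => /andP[]. Qed.

(** The spine of a book is a pair of vertices, and its pages are the common
    neighbours of that pair. *)
Lemma book_copyP lambda n (chi : {set 'I_n} -> bool) :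
  has_copy (book3 lambda) (colour_class chi true) <-> ~~ codeg_le lambda (red chi).
Proof.
split.
- case=> f [f_inj fH]; rewrite negb_forall; apply/existsP.
  pose x := f (inl ord0); pose y := f (inl ord_max).
  have xy : x != y by rewrite (inj_eq f_inj).
  exists [set x; y]; rewrite cards2 xy eqxx /= -ltnNge.
  pose g i := f (inr i).
  have g_inj : injective g by move=> i j /f_inj [].
  have <- : #|g @: [set: 'I_lambda.+1]| = lambda.+1 by rewrite card_imset // cardsT card_ord.
  apply/subset_leq_card/subsetP => _ /imsetP[i _ ->]; rewrite !inE !(inj_eq f_inj) /=.
  have := fH (book_edge i); rewrite imset_f // => /(_ isT).
  rewrite !inE eqb_id => /andP[].
  rewrite /book_edge finset.setUC imsetU1 imsetU1 imset_set1.
  by rewrite -/(g i) -/x -/y => /eqP -> ->.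
- rewrite negb_forall => /existsP[P]; rewrite negb_imply => /andP[/cards2P[x [y [xy ->]]]].
  rewrite -ltnNge => codeg.
  pose z (i : 'I_lambda.+1) : 'I_n := enum_val (widen_ord codeg i).
  have z_inj : injective z by move=> i j /enum_val_inj /(congr1 val) /= /val_inj.
  have zN i : z i \in nbr (red chi) [set x; y] by exact: enum_valP.
  pose f (s : 'I_2 + 'I_lambda.+1) := match s with
    inl j => if j == ord0 then x else y | inr i => z i end.
  have zxy i : ((z i == x) = false) * ((z i == y) = false).
    by have := zN i; rewrite !inE negb_or => /andP[/andP[/negbTE -> /negbTE ->]].
  have ord2 (j : 'I_2) : j = ord0 \/ j = ord_max.
    by case: j => [[|[|//]] h]; [left|right]; apply: val_inj.
  exists f; split.
  + move=> [j|i] [j'|i'] /=.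
    * by case: (ord2 j) => ->; case: (ord2 j') => -> //= /eqP; rewrite ?(negbTE xy) // eq_sym (negbTE xy).
    * by case: ifP => _ /esym/eqP; rewrite !zxy.
    * by case: ifP => _ /eqP; rewrite !zxy.
    * by move=> /z_inj ->.
  + move=> _ /imsetP[i _ ->]; rewrite !inE eqb_id.
    rewrite /book_edge finset.setUC imsetU1 imsetU1 imset_set1 /=.
    by have := zN i; rewrite !inE => /andP[_].
Qed.

Lemma complete_copyP t n (chi : {set 'I_n} -> bool) :
  has_copy (complete3 t) (colour_class chi false) <->
  exists S : {set 'I_n}, #|S| = t /\ indep (red chi) S.
Proof.
split.
- case=> f [f_inj fH]; exists (f @: [set: 'I_t]).
  split; first by rewrite card_imset // cardsT card_ord.
  apply/indepP => e; rewrite !inE => /andP[e3 chie]; apply/negP => /subsetP eS.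
  have fK : f @: (f @^-1: e) = e.
    apply/setP => i; apply/imsetP/idP => [[j]|ie]; first by rewrite inE => h ->.
    by have /imsetP[j _ ij] := eS i ie; exists j; rewrite // inE -ij.
  have /fH : f @^-1: e \in edges (complete3 t) by rewrite inE -(card_imset _ f_inj) fK.
  by rewrite fK !inE chie andbF.
- case=> S [St /indepP Sind].
  pose f (i : 'I_t) : 'I_n := enum_val (cast_ord (esym St) i).
  have f_inj : injective f by move=> i j /enum_val_inj /cast_ord_inj.
  exists f; split=> // e; rewrite !inE card_imset // => e3; rewrite e3 /=.
  have : f @: e \subset S by apply/subsetP => _ /imsetP[i _ ->]; exact: enum_valP.
  case chie: (chi _) => // fe; suff /Sind/negP : f @: e \in red chi by [].
  by rewrite !inE card_imset // e3.
Qed.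

(** * Sparse triple systems without large independent sets *)
Section SparseTripleSystem.
Variables (R : realType) (V : finType).
Implicit Types (S P Z : {set V}) (G H : {set {set V}}).

Definition triples_in S := [set e in triples V | e \subset S].
Definition pairs_in S := [set P : {set V} | (#|P| == 2%N) && (P \subset S)].
(** Neighbours inside [S] are left out: for fixed [S], the crowdedness of
    different pairs then depends on disjoint sets of triples, none of which lies
    inside [S]. *)
Definition crowded lambda S P G := (lambda <= #|nbr G P :\: S|)%N.

(** A triple of [G] inside [S] that is missing from a maximal [H] would raise
    the codegree of one of its pairs above [lambda].  The triples of [H] that
    make this pair full are not contained in [S], by independence. *)
Lemma maximal_triple_system lambda G :
  exists H, [/\ H \subset triples V, codeg_le lambda H &
    forall S, indep H S -> forall e, e \in G :&: triples_in S ->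
      exists2 P, P \in pairs_in S & (P \subset e) && crowded lambda S P G].
Proof.
pose ok H := (H \subset G :&: triples V) && codeg_le lambda H.
have ok0 : ok finset.set0.
  rewrite /ok finset.sub0set /=; apply/codeg_leP => P _.
  by rewrite [nbr _ _](_ : _ = finset.set0) ?cards0 //; apply/setP => z; rewrite !inE andbF.
have [H Hmax _] := maxset_exists ok0.
have [/andP[HG Hcodeg] {}Hmax] := maxsetP Hmax.
exists H; split=> //; first by apply: (subset_trans HG); exact: finset.subsetIr.
move=> S /indepP Sind e; rewrite !inE => /and3P[eG e3 eS].
have eH : e \notin H by apply: contraL eS; exact: Sind.
have : ~~ ok (e |: H).
  by apply: contraNN eH => /Hmax <-; rewrite ?setU11 ?finset.subsetUr.
rewrite negb_and subUset finset.sub1set inE eG inE e3 HG /=.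
case/forallPn=> P; rewrite negb_imply -ltnNge => /andP[P2 codegP].
have leH := codeg_leP _ _ Hcodeg P (eqP P2).
(* Adding [e] raises the codegree of [P], so that [e] contains [P]. *)
have : ~~ (nbr (e |: H) P \subset nbr H P).
  by apply: contraL (leq_ltn_trans leH codegP) => /subset_leq_card; rewrite -leqNgt.
case/subsetPn => z; rewrite !inE => /andP[zP ze] zH.
have {ze} ze : z |: P = e.
  by move: ze zH; rewrite zP /= => /orP[/eqP //|->].
have Pe : P \subset e by rewrite -ze finset.subsetUr.
have PS := subset_trans Pe eS.
exists P; first by rewrite inE P2.
rewrite Pe /= /crowded -ltnS (leq_trans codegP) //.
have -> : (#|nbr G P :\: S|.+1 = #|z |: (nbr G P :\: S)|)%N.
  rewrite cardsU1 inE negb_and negbK [z \in S](subsetP eS) //.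
  by rewrite -ze setU11.
apply/subset_leq_card/subsetP => x; rewrite !inE => /andP[xP /orP[/eqP xe|xH]].
  have : x \in z |: P by rewrite ze -xe setU11.
  by rewrite !inE (negbTE xP) orbF => ->.
apply/orP; right; rewrite xP /= andbC.
have /setIP[-> _] := subsetP HG _ xH.
by apply: contraL (Sind _ xH) => xS; rewrite negbK subUset finset.sub1set xS.
Qed.

Lemma card_triples_in S : #|triples_in S| = 'C(#|S|, 3).
Proof.
by rewrite -(cards_draws S 3); apply: eq_card => e; rewrite !inE andbC.
Qed.

Lemma card_pairs_in S : #|pairs_in S| = 'C(#|S|, 2).
Proof.
by rewrite -(cards_draws S 2); apply: eq_card => e; rewrite !inE andbC.
Qed.

Lemma card_triples_through S P : P \in pairs_in S ->
  (#|[set e in triples_in S | P \subset e]| <= #|S| - 2)%N.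
Proof.
rewrite inE => /andP[/eqP P2 PS].
have -> : (#|S| - 2 = #|S :\: P|)%N by rewrite cardsD (setIidPr PS) P2.
apply: leq_trans (leq_imset_card (fun z => z |: P) _).
apply/subset_leq_card/subsetP => e; rewrite !inE => /andP[/andP[/eqP e3 eS] Pe].
have /cards1P[z eP] : #|e :\: P| == 1%N by rewrite cardsD (setIidPr Pe) e3 P2.
apply/imsetP; exists z; last by rewrite -eP -[LHS](setID e P) (setIidPr Pe) finset.setUC.
by have : z \in e :\: P; [rewrite eP inE|rewrite !inE => /andP[-> /(subsetP eS)]].
Qed.


Definition block S P := [set z |: P | z in ~: S].

Lemma setU1_outside_inj S P : P \subset S -> {in ~: S &, injective (fun z => z |: P)}.
Proof.
move=> PS x y; rewrite !inE => xS yS /setP/(_ x).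
rewrite !inE eqxx /= => /esym/orP[/eqP //|/(subsetP PS)].
by rewrite (negbTE xS).
Qed.

Lemma block_disjoint S P Q : P \in pairs_in S -> Q \in pairs_in S -> P != Q ->
  [disjoint block S P & block S Q].
Proof.
rewrite !inE => /andP[_ PS] /andP[_ QS]; apply: contraNT.
case/pred0Pn => _ /andP[/= /imsetP[x + ->] /imsetP[y]]; rewrite !inE => xS yS xy.
have tr z (A : {set V}) : z \notin S -> A \subset S -> (z |: A) :&: S = A.
  move=> zS AS; apply/setP => i; rewrite !inE.
  case: (eqVneq i z) => [->|_] /=; first by rewrite (negbTE zS); apply/esym/negbTE; apply: contra zS => /(subsetP AS).
  by case iA: (i \in A) => //=; rewrite (subsetP AS).
by rewrite -(tr x P) // xy tr.
Qed.

Lemma crowded_depends lambda S P :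
  depends_on (block S P) (fun G => (crowded lambda S P G)%:R : R).
Proof.
move=> G; congr (_ %:R); rewrite /crowded; congr (nat_of_bool (_ <= _)%N).
apply: eq_card => z; rewrite !inE; case: (boolP (z \in S)) => //= zS.
by rewrite (imset_f (fun z => z |: P)) ?inE // andbT.
Qed.

Lemma crowded_outside lambda S P G : P \in pairs_in S ->
  crowded lambda S P (G :\: triples_in S) = crowded lambda S P G.
Proof.
move=> PS; rewrite /crowded; congr (_ <= _)%N.
apply: eq_card => z; rewrite !inE; case: (boolP (z \in S)) => //= zS.
suff -> : z |: P \subset S = false by rewrite andbF.
by rewrite subUset finset.sub1set (negbTE zS).
Qed.

Variable p : R.
Hypothesis p01 : 0 <= p <= 1.
Let E := expect (fun _ : {set V} => p).

(** Union bound over the sets of [lambda] neighbours.  The bound decays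
    exponentially in [lambda], which Markov's inequality for the codegree would
    not give. *)
Lemma expect_crowded lambda S P : P \in pairs_in S ->
  E (fun G => (crowded lambda S P G)%:R) <= 'C(#|V|, lambda)%:R * p ^+ lambda.
Proof.
move=> PS; have PsubS : P \subset S by move: PS; rewrite inE => /andP[].
pose D := [set Z : {set V} | (Z \subset ~: S) && (#|Z| == lambda)].
have cardD : (#|D| <= 'C(#|V|, lambda))%N.
  by rewrite cards_draws leq_bin2l // max_card.
apply: (@le_trans _ _ (\sum_(Z in D) p ^+ lambda)); last first.
  by rewrite sumr_const -[leLHS]mulr_natl ler_wpM2r ?ler_nat // exprn_ge0 //; case/andP: p01.
have -> : \sum_(Z in D) p ^+ lambda
    = E (fun G => \sum_(Z in D) ([set z |: P | z in Z] \subset G)%:R).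
  rewrite /E expect_sum; apply: eq_bigr => Z; rewrite inE => /andP[ZS /eqP <-].
  rewrite expect_sub prodr_const; congr (_ ^+ _); rewrite card_in_imset //.
  by move=> x y xZ yZ; apply: (setU1_outside_inj PsubS); apply: (subsetP ZS).
apply: le_expect => // G; case: (boolP (crowded _ _ _ _)) => /= [|_]; last exact: sumr_ge0.
rewrite /crowded -bin_gt0 -(cards_draws _ lambda) card_gt0 => /finset.set0Pn[Z].
rewrite inE => /andP[ZN Zl].
rewrite (bigD1 Z) /=; last first.
  by rewrite inE Zl andbT; apply/subsetP => z /(subsetP ZN); rewrite !inE => /andP[].
rewrite (_ : _ \subset G) ?lerDl ?sumr_ge0 //.
apply/subsetP => _ /imsetP[z zZ ->].
by have := subsetP ZN z zZ; rewrite !inE => /and3P[].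
Qed.

(** By [maximal_triple_system] this event, which refers to [G] alone, contains
    the independence of [S] in the maximal subsystem. *)
Definition blocked lambda S G := [forall e in G :&: triples_in S,
  exists P in pairs_in S, (P \subset e) && crowded lambda S P G].

Definition uncovered lambda S G := [set e in triples_in S |
  ~~ [exists P in pairs_in S, (P \subset e) && crowded lambda S P G]].

(** Each crowded pair covers at most [#|S| - 2] triples of [S]. *)
Lemma card_uncovered lambda S G :
  ('C(#|S|, 3) <= #|uncovered lambda S G|
     + \sum_(P in pairs_in S) crowded lambda S P G * (#|S| - 2))%N.
Proof.
have -> : (#|uncovered lambda S G| = \sum_(e in triples_in S) (e \in uncovered lambda S G))%N.
  rewrite -sum1_card -big_mkcondr; apply: eq_bigl => e.
  by rewrite /uncovered !inE andbA andbb.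
apply: (@leq_trans (\sum_(e in triples_in S) ((e \in uncovered lambda S G)
    + \sum_(P in pairs_in S) crowded lambda S P G * (P \subset e)))%N).
  rewrite -card_triples_in -sum1_card; apply: leq_sum => e eS.
  rewrite inE eS /=; case: (boolP [exists P in _, _]) => //= /exists_inP[P PS /andP[Pe Pc]].
  by rewrite (bigD1 P) //= Pe Pc.
rewrite big_split leq_add2l exchange_big leq_sum // => P PS.
rewrite -big_distrr leq_mul2l; apply/orP; right => /=.
apply: leq_trans (card_triples_through PS).
rewrite -sum1_card -big_mkcondr; apply/eq_leq/eq_bigl => e.
by rewrite !inE.
Qed.

(** Given the triples that are not inside [S], blocking says that [G] misses a
    fixed set of triples inside [S]. *)
Lemma blocked_resample lambda S G :
  blocked lambda S G = [disjoint uncovered lambda S (G :\: triples_in S) & G :&: triples_in S].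
Proof.
rewrite disjoint_sym disjoint_subset /blocked.
apply/forall_inP/subsetP => h e eG; move: (h e eG); rewrite !inE.
  move=> /exists_inP[P PS Pe]; rewrite negb_and negbK; apply/orP; right.
  by apply/exists_inP; exists P; rewrite ?crowded_outside.
move: (eG); rewrite !inE => /and3P[_ -> ->] /=; rewrite negbK => /exists_inP[P PS].
by rewrite crowded_outside // => Pe; apply/exists_inP; exists P.
Qed.

Lemma expect_blocked_given lambda S : E (fun G => (blocked lambda S G)%:R) =
  E (fun G => (1 - p) ^+ #|uncovered lambda S (G :\: triples_in S)|).
Proof.
set A := triples_in S.
transitivity (E (fun G => E (fun U =>
    [disjoint uncovered lambda S (G :\: A) & U :&: A]%:R))).
  rewrite /E -(expect_resample _ A (fun X Y => [disjoint uncovered lambda S Y & X]%:R)).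
  by apply: eq_expect => G; rewrite blocked_resample.
apply: eq_expect => G; rewrite -prodr_const -[RHS]expect_disjoint.
apply: eq_expect => U; congr (_ %:R).
have uncA : uncovered lambda S (G :\: A) \subset A.
  by apply/subsetP => e; rewrite inE => /andP[].
by rewrite -!finset.setI_eq0 [U :&: A]finset.setIC finset.setIA (setIidPl uncA).
Qed.

(** Given the triples that are not inside [S], blocking has probability
    (1 - p)^u, where u counts the uncovered triples.  Each crowded pair lowers u
    by at most t - 2, that is, costs a factor of at most e^{p (t - 2)}; these
    factors are independent for different pairs. *)
Lemma expect_blocked lambda t S : #|S| = t ->
  E (fun G => (blocked lambda S G)%:R) <=
  expR (- (p * 'C(t, 3)%:R)) *
  (1 + (expR (p * (t - 2)%:R) - 1) * ('C(#|V|, lambda)%:R * p ^+ lambda)) ^+ 'C(t, 2).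
Proof.
move=> St; have /andP[p0 p1] := p01.
set u := p * (t - 2)%:R.
pose weight P G := 1 + (expR u - 1) * (crowded lambda S P G)%:R.
have expu : 0 <= expR u - 1 by rewrite subr_ge0 -expR0 ler_expR mulr_ge0.
apply: (@le_trans _ _ (E (fun G => expR (- (p * 'C(t, 3)%:R)) *
    \prod_(P <- enum (pairs_in S)) weight P G))).
  rewrite expect_blocked_given; apply: le_expect => // G.
  have le_exp : 1 - p <= expR (- p) by rewrite expR_ge1Dx.
  apply: (@le_trans _ _ (expR (- p) ^+ #|uncovered lambda S (G :\: triples_in S)|)).
    by rewrite lerXn2r // ?nnegrE ?subr_ge0 ?expR_ge0.
  have -> : \prod_(P <- enum (pairs_in S)) weight P G =
      expR (\sum_(P in pairs_in S) (crowded lambda S P G)%:R * u).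
    rewrite expR_sum big_enum; apply: eq_bigr => P _; rewrite /weight.
    by case: crowded; rewrite /= ?mul0r ?mul1r ?expR0 ?mulr0 ?addr0 // mulr1 subrKC.
  rewrite -expRD -expRM_natl ler_expR mulrN.
  have := card_uncovered lambda S (G :\: triples_in S).
  under eq_bigr => P PS do rewrite crowded_outside //.
  rewrite St -(ler_nat R) natrD natr_sum -mulr_suml.
  under eq_bigr do rewrite natrM.
  rewrite -mulr_suml /u => /(ler_wpM2l p0).
  set s := \sum_(_ in _) _; lra.
rewrite /E expectZ ler_wpM2l ?expR_ge0 // (@expect_prod _ _ _ _ _ (block S)) ?enum_uniq //.
- rewrite big_enum /=; apply: (@le_trans _ _ (\prod_(P in pairs_in S)
    (1 + (expR u - 1) * ('C(#|V|, lambda)%:R * p ^+ lambda)))); last first.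
    by rewrite prodr_const card_pairs_in St.
  apply: ler_prod => P PS; rewrite /weight expectD expect1 expectZ.
  rewrite lerD2l ler_wpM2l ?expect_crowded // andbT addr_ge0 // mulr_ge0 //.
  by apply: sumr_ge0 => G _; rewrite mulr_ge0 ?bernw_ge0.
- by move=> P Q; rewrite !mem_enum => PS QS; exact: block_disjoint.
- by move=> P G; rewrite /weight (crowded_depends lambda S P G).
Qed.

(** Union bound over the sets of size [t]. *)
Lemma exists_triple_system lambda t :
    'C(#|V|, t)%:R * (expR (- (p * 'C(t, 3)%:R)) *
      (1 + (expR (p * (t - 2)%:R) - 1) * ('C(#|V|, lambda)%:R * p ^+ lambda)) ^+ 'C(t, 2)) < 1 ->
  exists H, [/\ H \subset triples V, codeg_le lambda H &
    forall S, #|S| = t -> ~~ indep H S].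
Proof.
pose D := [set S : {set V} | #|S| == t].
have cardD : #|D| = 'C(#|V|, t).
  rewrite -(cardsT V) -cards_draws; apply: eq_card => S.
  by rewrite !inE finset.subsetT.
move=> lt1.
have [||G Gfree] := @expect_lt1 R _ (fun=> p) _ (fun G => \sum_(S in D) (blocked lambda S G)%:R).
- by move=> _.
- rewrite expect_sum; apply: le_lt_trans lt1.
  rewrite -cardD mulr_natl -sumr_const; apply: ler_sum => S; rewrite inE => /eqP St.
  exact: expect_blocked.
have [H [H3 Hcodeg Hind]] := maximal_triple_system lambda G.
exists H; split=> // S St; apply/negP => /Hind indS.
have bl : blocked lambda S G.
  by apply/forall_inP => e /indS [P PS Pe]; apply/exists_inP; exists P.
move: Gfree; rewrite (bigD1 S) ?inE ?St //= bl.
by rewrite -[ltRHS]addr0 ltrD2l ltNge sumr_ge0.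
Qed.
End SparseTripleSystem.

(** * Numerical estimates for the random triple system *)
Section RealBounds.
Variable R : realType.
Implicit Types (x y c d : R).

(** Repeated squaring with rounding keeps the rational bounds short. *)
Lemma expR_double x c d : expR x <= c -> c ^+ 2 <= d -> expR (x * 2) <= d.
Proof.
move=> xc; apply: le_trans; rewrite expRM_natr lerXn2r // nnegrE ?expR_ge0 //.
exact: le_trans xc; exact: expR_ge0.
Qed.

Lemma expR_le_inv x c : x < 1 -> 1 <= c * (1 - x) -> expR x <= c.
Proof.
move=> x1 c1; rewrite -[x]opprK expRN; have x0 : 0 < 1 - x by rewrite subr_gt0.
apply: (@le_trans _ _ (1 - x)^-1); last by rewrite -div1r ler_pdivrMr.
by rewrite lef_pV2 ?posrE ?expR_gt0 // expR_ge1Dx.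
Qed.

Lemma expR1_le3 : expR 1 <= 3 :> R.
Proof.
have h : expR (1 / 8) <= 8 / 7 :> R by apply: expR_le_inv; lra.
have -> : 1 = 1 / 8 * 2 * 2 * 2 :> R by lra.
by apply: (@expR_double _ (1709 / 1000)); [apply: (@expR_double _ (1307 / 1000)); [apply: expR_double h _|]|]; clear; lra.
Qed.

Lemma expR6_le480 : expR 6 <= 480 :> R.
Proof.
have h : expR (6 / 128) <= 64 / 61 :> R by apply: expR_le_inv; lra.
have -> : 6 = 6 / 128 * 2 * 2 * 2 * 2 * 2 * 2 * 2 :> R by lra.
have h1 := @expR_double _ _ (11008 / 10000) h ltac:(clear; lra).
have h2 := @expR_double _ _ (12119 / 10000) h1 ltac:(clear; lra).
have h3 := @expR_double _ _ (14688 / 10000) h2 ltac:(clear; lra).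
have h4 := @expR_double _ _ (21575 / 10000) h3 ltac:(clear; lra).
have h5 := @expR_double _ _ (4655 / 1000) h4 ltac:(clear; lra).
have h6 := @expR_double _ _ (2167 / 100) h5 ltac:(clear; lra).
by apply: expR_double h6 _; clear; lra.
Qed.

Lemma ln_ge_of_expR x y : expR y <= x -> y <= ln x.
Proof.
move=> yx; rewrite -ler_expR lnK // posrE; exact: lt_le_trans (expR_gt0 _) yx.
Qed.

Lemma expR_natX (k : nat) : expR k%:R <= 3 ^+ k :> R.
Proof.
by rewrite -[k%:R]mulr1 expRM_natl lerXn2r ?nnegrE ?expR_ge0 // expR1_le3.
Qed.

(** Bootstrapping: a bound k <= ln x gives 96 k < x, which improves k; 480 is
    96 * 5. *)
Lemma ln_mul_ge6 x : 3 <= x -> 96 * ln x < x -> 6 <= ln x.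
Proof.
move=> x3 Lx.
have L1 : 1 <= ln x by apply/ln_ge_of_expR/(le_trans expR1_le3).
have L4 : 4 <= ln x by apply/ln_ge_of_expR/(le_trans (expR_natX 4)); lra.
have L5 : 5 <= ln x by apply/ln_ge_of_expR/(le_trans (expR_natX 5)); lra.
by apply/ln_ge_of_expR/(le_trans expR6_le480); lra.
Qed.

(** Induction with (1 + 1/k)^k <= e <= 3.  The factor 3 saved for [k != 0] is
    what makes [crowded_weight_le] true for small [lambda]. *)
Lemma expn_le_fact (k : nat) : k%:R ^+ k <= 3 ^+ k / 3 ^+ (k != 0%N) * k`!%:R :> R.
Proof.
elim: k => [|k IHk]; first by rewrite !expr0 divr1 mul1r.
case: k IHk => [|k] IHk; first by rewrite !expr1 divff ?mul1r.
have k0 : 0 < k.+1%:R :> R by rewrite ltr0n.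
have -> : k.+2%:R ^+ k.+2 = k.+2%:R * ((1 + k.+1%:R^-1) ^+ k.+1 * k.+1%:R ^+ k.+1) :> R.
  have E : (1 + k.+1%:R^-1) * k.+1%:R = k.+2%:R :> R.
    by rewrite [k.+2%:R]mulrS mulrDl mulVf ?gt_eqF // mul1r addrC.
  by rewrite -exprMn E exprS.
have h : (1 + k.+1%:R^-1) ^+ k.+1 <= 3 :> R.
  apply: le_trans expR1_le3.
  have -> : expR 1 = expR k.+1%:R^-1 ^+ k.+1 :> R by rewrite -expRM_natl divff ?gt_eqF.
  by rewrite lerXn2r ?nnegrE ?expR_ge0 ?expR_ge1Dx // addr_ge0 // invr_ge0 ltW.
rewrite factS natrM [leRHS]mulrCA ler_pM2l ?ltr0n //.
apply: (@le_trans _ _ (3 * k.+1%:R ^+ k.+1)).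
  by rewrite ler_wpM2r ?exprn_ge0 // ltW.
rewrite [3 ^+ k.+2]exprS -!mulrA ler_pM2l //; apply: le_trans IHk _.
by rewrite mulrA.
Qed.

Lemma bin_le_expn (n k : nat) : 'C(n, k)%:R * k`!%:R <= n%:R ^+ k :> R.
Proof.
rewrite -natrM bin_ffact -natrX ler_nat /falling_factorial.
elim: k n => //= k IHk n; rewrite expnS leq_mul2l; apply/orP; right.
by apply: leq_trans (IHk _) _; case: k {IHk} => // k; rewrite leq_exp2r // leq_pred.
Qed.

Lemma bin3E (n : nat) : (2 <= n)%N -> 'C(n, 3)%:R * 6 = n%:R * (n%:R - 1) * (n%:R - 2) :> R.
Proof.
move=> n2; have -> : 6 = 3`!%:R :> R by [].
rewrite -natrM bin_ffact !ffactnS ffactn0 muln1 -subn1 -subn1 -subnDA !natrM !natrB ?(ltnW n2) //.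
by rewrite mulrA.
Qed.

Lemma bin2E (n : nat) : (1 <= n)%N -> 'C(n, 2)%:R * 2 = n%:R * (n%:R - 1) :> R.
Proof.
move=> n1; have -> : 2 = 2`!%:R :> R by [].
by rewrite -natrM bin_ffact !ffactnS ffactn0 muln1 -subn1 natrM natrB.
Qed.

(** With e^u - 1 <= u e^u and e^{1/7} <= 7/6, the left-hand side is at most
    u (lambda / 6)^lambda / lambda!, and lambda^lambda / lambda! is at most
    3^{lambda - 1}. *)
Lemma crowded_weight_le (n lambda : nat) (p u : R) : (0 < lambda)%N -> 0 <= p ->
    n%:R * p <= lambda%:R / 7 -> 0 <= u <= lambda%:R / 7 ->
  (expR u - 1) * ('C(n, lambda)%:R * p ^+ lambda) <= u / 6.
Proof.
move=> l0 p0 np /andP[u0 ul]; set q := 'C(n, lambda)%:R * p ^+ lambda.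
have q0 : 0 <= q by rewrite mulr_ge0 ?exprn_ge0.
have eu : expR u - 1 <= u * expR u.
  have := ler_wpM2l (expR_ge0 u) (expR_ge1Dx (- u)).
  by rewrite expRN divff ?gt_eqF ?expR_gt0 //; lra.
apply: (@le_trans _ _ (u * expR u * q)); first by rewrite ler_wpM2r.
rewrite -mulrA ler_wpM2l //.
apply: (@le_trans _ _ (expR (lambda%:R / 7) * q)); first by rewrite ler_wpM2r // ler_expR.
have f0 : 0 < lambda`!%:R :> R by rewrite ltr0n fact_gt0.
have e7 : expR (1 / 7) <= 7 / 6 :> R by apply: expR_le_inv; lra.
rewrite -(ler_pM2r f0) -[lambda%:R / 7]mulrC -mulrA.
have -> : expR (7^-1 * lambda%:R) = expR (1 / 7) ^+ lambda :> R by rewrite div1r expRM_natr.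
have qf : q * lambda`!%:R <= (lambda%:R / 7) ^+ lambda.
  apply: (@le_trans _ _ ((n%:R * p) ^+ lambda)).
    by rewrite exprMn /q mulrAC ler_wpM2r ?exprn_ge0 // bin_le_expn.
  by rewrite lerXn2r ?nnegrE // ?mulr_ge0 // invr_ge0.
apply: (@le_trans _ _ ((7 / 6) ^+ lambda * (lambda%:R / 7) ^+ lambda)).
  apply: ler_pM => //; first exact: mulr_ge0.
  by rewrite lerXn2r ?nnegrE ?expR_ge0 //; lra.
have := expn_le_fact lambda; rewrite -lt0n l0 expr1 => lf.
rewrite -exprMn (_ : 7 / 6 * (lambda%:R / 7) = 6^-1 * lambda%:R); last by field.
rewrite exprMn; apply: le_trans (ler_wpM2l _ lf) _; first by rewrite exprn_ge0 ?invr_ge0.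
rewrite !mulrA ler_wpM2r ?(ltW f0) // -exprMn (_ : 6^-1 * 3 = 2^-1); last by field.
have : (2^-1) ^+ lambda <= 2^-1 :> R.
  by rewrite -[leRHS]expr1 ler_wiXn2l ?invr_ge0 //; lra.
lra.
Qed.

(** The number of t-sets is less than (lambda t)^t = e^{L t}, while the other
    factors multiply to at most e^{- p t (t - 1) (t - 2) / 12}, whose exponent is
    - (8/7) L (t - 1) (t - 2) / t.  This suffices as soon as
    t^2 - 24 t + 16 >= 0, and the two upper bounds on 96 L force L >= 6 and
    t >= 24. *)
Lemma sparse_weight_lt1 (n t lambda : nat) (p : R) (L := ln (lambda * t)%:R) :
    (3 <= t)%N -> (0 < lambda)%N ->
    96 * L < t%:R ^+ 2 -> 96 * L < (lambda * t)%:R ->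
    n%:R <= lambda%:R * t%:R ^+ 2 / (96 * L) ->
    p = 96 * L / (7 * t%:R ^+ 2) ->
  'C(n, t)%:R * (expR (- (p * 'C(t, 3)%:R)) *
    (1 + (expR (p * (t - 2)%:R) - 1) * ('C(n, lambda)%:R * p ^+ lambda)) ^+ 'C(t, 2)) < 1.
Proof.
move=> t3 l0 Lt Lx nle pE.
have x3 : 3 <= (lambda * t)%:R :> R.
  by rewrite (ler_nat _ 3) (leq_trans t3) // leq_pmull.
have L6 : 6 <= L by exact: ln_mul_ge6.
have T0 : 0 < t%:R :> R by rewrite ltr0n (leq_trans _ t3).
have l0R : 0 < lambda%:R :> R by rewrite ltr0n.
have T24 : 24 <= t%:R :> R by nra.
have p0 : 0 < p by rewrite pE divr_gt0 ?mulr_gt0 ?exprn_gt0 //; lra.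
have pT : p * t%:R * t%:R = 96 / 7 * L by rewrite pE; field; rewrite gt_eqF.
have np : n%:R * p <= lambda%:R / 7.
  apply: le_trans (ler_wpM2r (ltW p0) nle) _.
  rewrite pE le_eqVlt; apply/orP; left; apply/eqP; field.
  by rewrite !gt_eqF //; lra.
have t2E : (t - 2)%:R = t%:R - 2 :> R by rewrite natrB // (leq_trans _ t3).
have pt : p * t%:R <= lambda%:R / 7.
  rewrite -(ler_pM2r T0) pT; move: Lx; rewrite natrM; lra.
set u := p * (t - 2)%:R.
have u0 : 0 <= u by rewrite /u mulr_ge0 // ltW.
have ul : u <= lambda%:R / 7 by rewrite /u t2E; nra.
have cw := crowded_weight_le l0 (ltW p0) np (introT andP (conj u0 ul)).
set w := (expR u - 1) * _ in cw *.
have w0 : 0 <= w.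
  by rewrite /w mulr_ge0 ?subr_ge0 -?expR0 ?ler_expR // mulr_ge0 ?exprn_ge0 // ltW.
have wpow : (1 + w) ^+ 'C(t, 2) <= expR ('C(t, 2)%:R * (u / 6)).
  rewrite expRM_natl lerXn2r ?nnegrE ?expR_ge0 ?addr_ge0 //.
  by apply: le_trans (expR_ge1Dx _); rewrite lerD2l.
have sets : 'C(n, t)%:R < expR (t%:R * L).
  have t0 : (t != 0)%N by rewrite -lt0n (leq_trans _ t3).
  have f0 : 0 < t`!%:R :> R by rewrite ltr0n fact_gt0.
  rewrite -(ltr_pM2r f0); apply: le_lt_trans (bin_le_expn _ _) _.
  have tf : t%:R ^+ t <= 3 ^+ t * t`!%:R :> R.
    apply: le_trans (expn_le_fact t) _; rewrite ler_wpM2r ?(ltW f0) // t0.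
    by rewrite ler_pdivrMr // expr1; have := @exprn_ge0 R t 3; lra.
  have nx : n%:R <= (3^-1 / 2 * (lambda * t)%:R) * t%:R :> R.
    apply: le_trans nle _; rewrite ler_pdivrMr; last by lra.
    have a0 : 0 <= lambda%:R * t%:R * t%:R :> R by rewrite !mulr_ge0.
    by rewrite natrM; have := ler_wpM2l a0 L6; lra.
  rewrite expRM_natl lnK ?posrE; last by lra.
  apply: (@le_lt_trans _ _ ((3^-1 / 2 * (lambda * t)%:R * t%:R) ^+ t)).
    by rewrite lerXn2r ?nnegrE // !mulr_ge0.
  rewrite exprMn; apply: le_lt_trans (ler_wpM2l _ tf) _; first by rewrite exprn_ge0 // !mulr_ge0.
  rewrite mulrA -exprMn ltr_pM2r // ltrXn2r //; try lra.
apply: (@lt_le_trans _ _ (expR (t%:R * L) *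
   (expR (- (p * 'C(t, 3)%:R)) * expR ('C(t, 2)%:R * (u / 6))))).
  apply: (@le_lt_trans _ _ ('C(n, t)%:R *
     (expR (- (p * 'C(t, 3)%:R)) * expR ('C(t, 2)%:R * (u / 6))))).
    by rewrite ler_wpM2l // ler_wpM2l ?expR_ge0.
  by rewrite ltr_pM2r // mulr_gt0 ?expR_gt0.
rewrite -!expRD -[leRHS]expR0 ler_expR.
have C3 := bin3E (ltnW t3); have C2 := bin2E (ltnW (ltnW t3)).
have -> : 'C(t, 3)%:R = t%:R * (t%:R - 1) * (t%:R - 2) / 6 :> R by lra.
have -> : 'C(t, 2)%:R = t%:R * (t%:R - 1) / 2 :> R by lra.
rewrite /u t2E -(ler_pM2r T0) mul0r.
have -> : (t%:R * L + (- (p * (t%:R * (t%:R - 1) * (t%:R - 2) / 6)) +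
   t%:R * (t%:R - 1) / 2 * (p * (t%:R - 2) / 6))) * t%:R
  = t%:R ^+ 2 * L - (p * t%:R * t%:R) * ((t%:R - 1) * (t%:R - 2) / 12) by field.
rewrite pT.
have -> : t%:R ^+ 2 * L - 96 / 7 * L * ((t%:R - 1) * (t%:R - 2) / 12)
  = - (L * (t%:R * (t%:R - 24) + 16) / 7) by field.
rewrite oppr_le0 divr_ge0 // mulr_ge0 //; nra.
Qed.

End RealBounds.

(** * The lower bound *)
Lemma not_arrow_of_triple_system n lambda t (H : {set {set 'I_n}}) :
    H \subset triples 'I_n -> codeg_le lambda H ->
    (forall S : {set 'I_n}, #|S| = t -> ~~ indep H S) ->
  ~ ramsey_arrow n (book3 lambda) (complete3 t).
Proof.
move=> H3 Hcodeg Hind arrow.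
have redH : red (fun e => e \in H) = H.
  by apply/setP => e; rewrite inE; apply: andb_idl; exact: (subsetP H3).
case: (arrow (fun e => e \in H)) => [/book_copyP|/complete_copyP[S [St]]].
  by rewrite redH Hcodeg.
by rewrite redH (negbTE (Hind S St)).
Qed.

(** Outside the range of [sparse_weight_lt1] either n <= lambda, and all triples
    may be red, or n < t, and all may be blue. *)
Lemma ramsey_lower (R : realType) (n t lambda : nat) : (3 <= t)%N -> (0 < lambda)%N ->
    ramsey_arrow n (book3 lambda) (complete3 t) ->
  lambda%:R * t%:R ^+ 2 / (96 * ln ((lambda * t)%:R : R)) <= n%:R.
Proof.
move=> t3 l0 arrow; rewrite leNgt; apply/negP => nlt.
set L := ln (lambda * t)%:R in nlt.
have T0 : 0 < t%:R :> R by rewrite ltr0n (leq_trans _ t3).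
have l0R : 0 < lambda%:R :> R by rewrite ltr0n.
have L0 : 0 < L.
  by rewrite ln_gt0 // ltr1n (leq_trans _ (leq_pmull t l0)) // ltnW.
have L96 : 0 < 96 * L by rewrite mulr_gt0.
case: (leP (t%:R ^+ 2) (96 * L)) => [le_t2|lt_t2].
  have nl : (n <= lambda)%N.
    rewrite -(ler_nat R); apply/ltW/(lt_le_trans nlt).
    by rewrite ler_pdivrMr // ler_wpM2l // ltW.
  apply: (@not_arrow_of_triple_system n lambda t (triples 'I_n)) arrow => //.
    apply/codeg_leP => P _; apply: leq_trans nl.
    by rewrite -[X in (_ <= X)%N]card_ord max_card.
  move=> S St; have : (0 < #|triples_in S|)%N by rewrite card_triples_in bin_gt0 St.
  case/card_gt0P=> e; rewrite inE => /andP[e3 eS].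
  by apply/negP => /indepP/(_ e e3)/negP.
case: (leP (lambda * t)%:R (96 * L)) => [le_lt|lt_lt].
  have nt : (n < t)%N.
    rewrite -(ltr_nat R); apply/(lt_le_trans nlt).
    by rewrite ler_pdivrMr // expr2 mulrA mulrC ler_wpM2l ?(ltW T0) // -natrM.
  apply: (@not_arrow_of_triple_system n lambda t finset.set0) arrow => //.
  - exact: finset.sub0set.
  - apply/codeg_leP => P _; rewrite [nbr _ _](_ : _ = finset.set0) ?cards0 //.
    by apply/setP => z; rewrite !inE andbF.
  - by move=> S St; have := max_card (mem S); rewrite St card_ord leqNgt nt.
have pE := erefl (96 * L / (7 * t%:R ^+ 2)); set p := LHS in pE.
have T2 : 0 < 7 * t%:R ^+ 2 :> R by rewrite mulr_gt0 ?exprn_gt0.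
have p01 : 0 <= p <= 1.
  apply/andP; split; first by rewrite divr_ge0 ?ltW.
  by rewrite ler_pdivrMr // mul1r; have := exprn_gt0 2 T0; lra.
have [|H [H3 Hcodeg Hind]] := @exists_triple_system R 'I_n p p01 lambda t.
  by rewrite card_ord; apply: sparse_weight_lt1 pE => //; exact: ltW.
exact: not_arrow_of_triple_system H3 Hcodeg Hind arrow.
Qed.

(** * Random independent sets in a triple system *)
Lemma expR_third_le (R : realType) : expR (- (1 / 3)) <= 1 - 1 / 4 :> R.
Proof. by apply: expR_le_inv; lra. Qed.

(** Linearises the trade-off between [s] and [q >= e^{- 4 s / 3}], so that it
    can be summed over independent sets and averaged over samples; [l] is the
    logarithm of the threshold for [1 / q]. *)
Lemma tangent_bound (R : realType) (l s q : R) : expR (- (4 / 3 * s)) <= q ->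
  3 / 4 * (l - expR l * q) <= s.
Proof.
move=> /(ler_wpM2l (expR_ge0 l)); rewrite -expRD.
have := expR_ge1Dx (l - 4 / 3 * s); lra.
Qed.

Section IndependentSets.
Variables (R : realType) (V : finType) (H : {set {set V}}) (lambda : nat).
Hypothesis H3 : H \subset triples V.
Hypothesis Hcodeg : codeg_le lambda H.
Implicit Types (v : V) (P Q S U W X Y N T e : {set V}).

Definition ind U := [set W : {set V} | (W \subset U) && indep H W].

Definition link v := [set P : {set V} | (v \notin P) && (v |: P \in H)].

Definition link_in v W := [set P in link v | P \subset W].

Definition extensions v U := [set W in ind U | indep H (v |: W)].

Lemma card_edge3 e : e \in H -> #|e| = 3%N.
Proof. by move/(subsetP H3); rewrite inE => /eqP. Qed.

Lemma indep0 : indep H finset.set0.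
Proof.
by apply/indepP => e eH; rewrite finset.subset0 -cards_eq0 card_edge3.
Qed.

Lemma card_ind_gt0 U : (0 < #|ind U|)%N.
Proof.
by apply/card_gt0P; exists finset.set0; rewrite inE finset.sub0set indep0.
Qed.

Lemma card_link_pair v P : P \in link v -> #|P| = 2%N.
Proof. by rewrite inE => /andP[vP /card_edge3]; rewrite cardsU1 vP => -[]. Qed.

(** Double counting: a pair inside [W] is in the link of at most [lambda]
    vertices. *)
Lemma sum_link_in W : (\sum_v #|link_in v W| <= lambda * 'C(#|W|, 2))%N.
Proof.
rewrite mulnC -card_pairs_in -sum_nat_const.
have -> : (\sum_v #|link_in v W| = \sum_v \sum_(P in pairs_in W) (v \in nbr H P))%N.
  apply: eq_bigr => v _; rewrite -big_mkcondr sum1_card; apply: eq_card => P.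
  apply/idP/andP => [|[]]; rewrite !inE.
    case/andP=> /andP[vP vPH] PW; rewrite PW vP vPH.
    by rewrite (card_link_pair (v := v)) // inE vP.
  by case/andP=> _ -> /andP[-> ->].
rewrite exchange_big; apply: leq_sum => P; rewrite inE => /andP[/eqP P2 _].
apply: leq_trans (codeg_leP _ _ Hcodeg P P2).
by rewrite -big_mkcond sum1_card.
Qed.

Lemma card_edges_through P : #|P| = 2%N -> (#|[set e in H | P \subset e]| <= lambda)%N.
Proof.
move=> P2; apply: leq_trans (codeg_leP _ _ Hcodeg P P2).
apply: leq_trans (leq_imset_card (fun z => z |: P) _).
apply/subset_leq_card/subsetP => e; rewrite !inE => /andP[eH Pe].
have /cards1P[z eP] : #|e :\: P| == 1%N by rewrite cardsD (setIidPr Pe) card_edge3 // P2.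
have eE : e = z |: P by rewrite -eP -[LHS](setID e P) (setIidPr Pe) finset.setUC.
apply/imsetP; exists z => //; rewrite inE -eE eH andbT.
by have : z \in e :\: P; [rewrite eP inE|rewrite inE => /andP[]].
Qed.

Lemma card_link_at v a : (#|[set P in link v | a \in P]| <= lambda)%N.
Proof.
have [->|av] := eqVneq a v.
  by rewrite (_ : [set _ in _ | _] = finset.set0) ?cards0 //; apply/setP => P; rewrite !inE; case: (v \in P); rewrite ?andbF.
have va2 : #|[set v; a]| = 2%N by rewrite cards2 eq_sym av.
apply: leq_trans (card_edges_through va2).
rewrite -(card_in_imset (f := fun P => v |: P)); last first.
  move=> P Q; rewrite !inE => /andP[/andP[vP _] _] /andP[/andP[vQ _] _] PQ.
  by rewrite -(setU1K vP) PQ setU1K.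
apply/subset_leq_card/subsetP => _ /imsetP[P + ->]; rewrite !inE.
by case/andP=> /andP[_ ->] aP; rewrite subUset !finset.sub1set !inE eqxx aP orbT.
Qed.

Lemma card_bigcup_le (I : finType) (J : {set I}) (A : I -> {set {set V}}) (B : {set {set V}}) k :
    {in B, forall x, exists2 i, i \in J & x \in A i} ->
    (forall i, i \in J -> (#|A i| <= k)%N) -> (#|B| <= #|J| * k)%N.
Proof.
move=> cov Ak; rewrite -sum1_card -sum_nat_const.
apply: (@leq_trans (\sum_(x in B) \sum_(i in J) (x \in A i))%N).
  by apply: leq_sum => x xB; have [i iJ xA] := cov x xB; rewrite (bigD1 i) //= xA.
rewrite exchange_big; apply: leq_sum => i iJ; apply: leq_trans (Ak i iJ).
by rewrite -big_mkcondr sum1_card; apply/subset_leq_card/subsetP => x /andP[].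
Qed.

Lemma card_link v : (#|link v| <= #|V| * lambda)%N.
Proof.
rewrite -cardsT; apply: (card_bigcup_le (A := fun a => [set P in link v | a \in P])).
  move=> P Pv; have /card_gt0P[a aP] : (0 < #|P|)%N by rewrite (card_link_pair Pv).
  by exists a => //; rewrite inE Pv.
by move=> a _; exact: card_link_at.
Qed.

Lemma card_link_meeting v P : #|P| = 2%N ->
  (#|[set Q in link v | ~~ [disjoint P & Q]]| <= 2 * lambda)%N.
Proof.
move=> P2; rewrite -[in leqRHS]P2; apply: (card_bigcup_le (A := fun a => [set Q in link v | a \in Q])).
  by move=> Q; rewrite inE => /andP[Qv /pred0Pn[a /andP[/= aP aQ]]]; exists a => //; rewrite inE Qv.
by move=> a _; exact: card_link_at.
Qed.

Lemma card_edges_meeting P Q : #|P| = 2%N -> #|Q| = 2%N -> [disjoint P & Q] ->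
  (#|[set e in H | ~~ [disjoint e & P] && ~~ [disjoint e & Q]]| <= 4 * lambda)%N.
Proof.
move=> P2 Q2 PQ; have <- : #|setX P Q| = 4%N by rewrite cardsX P2 Q2.
apply: (card_bigcup_le (A := fun x => [set e in H | [set x.1; x.2] \subset e])).
  move=> e; rewrite inE => /and3P[eH /pred0Pn[a /andP[/= ae aP]] /pred0Pn[b /andP[/= be bQ]]].
  by exists (a, b); rewrite !inE ?aP ?bQ //= eH subUset !finset.sub1set ae be.
case=> a b; rewrite inE => /andP[/= aP bQ]; apply: card_edges_through.
by rewrite cards2; case: eqVneq bQ => // <-; rewrite (disjointFr PQ aP).
Qed.

(** Short cycles of the triple system through [v]: two pairs of the link that
    share a vertex, an edge containing a pair of the link, and an edge that joins
    two disjoint pairs of the link.  They span 3, 3 and 5 vertices besides [v].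
    The second sum admits the edge formed by the pair and [v] itself, which lies in
    no set [U] that avoids [v]. *)
Definition short_cycles v U : nat := (\sum_(P in link v)
  (\sum_(Q in link v | (Q != P) && ~~ [disjoint P & Q]) (P :|: Q \subset U)
   + \sum_(e in H | P \subset e) (e \subset U)
   + \sum_(Q in link v | [disjoint P & Q])
      \sum_(e in H | [&& ~~ [disjoint e & P], ~~ [disjoint e & Q],
                         ~~ (P \subset e) & ~~ (Q \subset e)])
        (P :|: Q :|: e \subset U)))%N.

Lemma expect_natsum_le (p : V -> R) (I : finType) (A : pred I) (F : I -> {set V} -> nat) (N : nat) (x : R) :
    0 <= x -> (#|A| <= N)%N ->
    (forall i, A i -> expect p (fun U => (F i U)%:R) <= x) ->
  expect p (fun U => (\sum_(i | A i) F i U)%:R) <= N%:R * x.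
Proof.
move=> x0 AN Fx; under eq_expect do rewrite natr_sum.
rewrite expect_sum; apply: (@le_trans _ _ (\sum_(i | A i) x)); first exact: ler_sum.
by rewrite sumr_const -[leLHS]mulr_natl ler_wpM2r // ler_nat.
Qed.

Section Sampling.
Variable rho : R.
Hypothesis rho01 : 0 <= rho <= 1.
Let E := expect (fun _ : V => rho).

Lemma expect_subD1 v (T : {set V}) k : (k <= #|T|)%N ->
  E (fun U => (T \subset U :\ v)%:R) <= rho ^+ k.
Proof.
have /andP[r0 r1] := rho01 => kT.
apply: (@le_trans _ _ (E (fun U => (T \subset U)%:R))).
  apply: le_expect => // U; rewrite ler_nat; case: (boolP (T \subset U :\ v)) => //.
  by move=> /subset_trans -> //; exact: finset.subsetDl.
by rewrite /E expect_sub prodr_const ler_wiXn2l.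
Qed.

(** Each configuration of k vertices survives in the sample with probability
    at most rho^k, and the codegree bound limits the number of ways in which a
    link pair extends to a configuration. *)
Lemma expect_short_cycles v : E (fun U => (short_cycles v (U :\ v))%:R) <=
  (#|V| * lambda)%:R * ((2 * lambda)%:R * rho ^+ 3 + lambda%:R * rho ^+ 3
     + (#|V| * lambda)%:R * ((4 * lambda)%:R * rho ^+ 5)).
Proof.
have /andP[r0 r1] := rho01; have rk k : 0 <= rho ^+ k by rewrite exprn_ge0.
apply: expect_natsum_le; first by rewrite !(addr_ge0, mulr_ge0).
  exact: card_link.
move=> P Pv; have P2 := card_link_pair Pv.
under eq_expect do rewrite !natrD.
rewrite !expectD; apply: lerD; first apply: lerD.
- apply: expect_natsum_le => //.
    apply: leq_trans (card_link_meeting v P2); apply/subset_leq_card/subsetP => Q.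
    by rewrite inE => /and3P[-> _ ->].
  move=> Q /and3P[Qv QP _]; apply: expect_subD1.
  have := cardsUI P Q; rewrite P2 (card_link_pair Qv) => PQ.
  rewrite -ltnS -[X in (_ < X)%N]addn1 ltnNge; apply: contraNN QP => le2.
  have PQ2 : (2 <= #|P :&: Q|)%N by lia.
  have e1 : P :&: Q = P by apply/eqP; rewrite eqEcard finset.subsetIl P2.
  have e2 : P :&: Q = Q by apply/eqP; rewrite eqEcard finset.subsetIr (card_link_pair Qv).
  by rewrite -e2 e1.
- apply: expect_natsum_le => //.
    apply: leq_trans (card_edges_through P2); apply/subset_leq_card/subsetP => e.
    by rewrite inE.
  by move=> e /andP[eH _]; apply: expect_subD1; rewrite card_edge3.
- apply: expect_natsum_le; first by rewrite mulr_ge0.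
    apply: leq_trans (card_link v); apply/subset_leq_card/subsetP => Q.
    by case/andP.
  move=> Q /andP[Qv PQ]; have Q2 := card_link_pair Qv.
  apply: expect_natsum_le => //.
    apply: leq_trans (card_edges_meeting P2 Q2 PQ); apply/subset_leq_card/subsetP => e.
    by rewrite !inE => /and5P[-> -> ->].
  move=> e /and5P[eH _ _ nPe nQe]; apply: expect_subD1.
  have PQ4 : #|P :|: Q| = 4%N by rewrite cardsU disjoint_setI0 // cards0 P2 Q2.
  rewrite ltnNge; apply/negP => le4.
  have /eqP eE : P :|: Q == P :|: Q :|: e by rewrite eqEcard finset.subsetUl PQ4.
  have ePQ : e \subset P :|: Q by rewrite eE finset.subsetUr.
  have le1 (A : {set V}) : #|A| = 2%N -> ~~ (A \subset e) -> (#|e :&: A| <= 1)%N.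
    move=> A2; rewrite -ltnS ltn_neqAle -{2}A2 subset_leq_card ?finset.subsetIr // andbT.
    apply: contraNN => /eqP eA; apply/setIidPr/eqP; rewrite eqEcard finset.subsetIr A2 eA //.
  have : (#|e| <= #|e :&: P| + #|e :&: Q|)%N.
    by rewrite -[in X in (X <= _)%N](setIidPl ePQ) finset.setIUr cardsU leq_subr.
  rewrite card_edge3 //; have := le1 _ P2 nPe; have := le1 _ Q2 nQe; lia.
Qed.

End Sampling.

Lemma no_short_cycles v U : short_cycles v U = 0%N ->
  {in link_in v U &, forall P Q, P != Q -> [disjoint P & Q]} /\
  forall e, e \in H -> e \subset U ->
    {in e :&: cover (link_in v U) &, forall x y, x = y}.
Proof.
move/eqP; rewrite sum_nat_eq0 => /forall_inP cyc.
have {}cyc P : P \in link v -> [/\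
    forall Q, Q \in link v -> Q != P -> ~~ [disjoint P & Q] -> ~~ (P :|: Q \subset U),
    forall e, e \in H -> P \subset e -> ~~ (e \subset U) &
    forall Q e, Q \in link v -> [disjoint P & Q] -> e \in H ->
      [&& ~~ [disjoint e & P], ~~ [disjoint e & Q], ~~ (P \subset e) & ~~ (Q \subset e)] ->
      ~~ (P :|: Q :|: e \subset U)].
  move=> Pv; have := cyc P Pv; rewrite !addn_eq0 !sum_nat_eq0 -andbA.
  case/and3P=> /forall_inP c1 /forall_inP c2 /forall_inP c3; split.
  - by move=> Q Qv QP PQ; rewrite -eqb0 c1 // Qv QP.
  - by move=> e eH Pe; rewrite -eqb0 c2 // eH.
  - move=> Q e Qv PQ eH he; have := c3 Q; rewrite Qv PQ => /(_ isT).
    by rewrite sum_nat_eq0 => /forall_inP/(_ e); rewrite eH he eqb0 => ->.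
have disj : {in link_in v U &, forall P Q, P != Q -> [disjoint P & Q]}.
  move=> P Q; rewrite !inE => /andP[Pv PU] /andP[Qv QU] PQ.
  have [|c1 _ _] := cyc P; first by rewrite inE.
  apply: contraT => nd; have := c1 Q; rewrite inE => /(_ Qv).
  by rewrite eq_sym PQ nd subUset PU QU => /(_ isT isT).
split=> // e eH eU x y; rewrite !inE => /andP[xe /bigcupP[P PM xP]] /andP[ye /bigcupP[Q QM yQ]].
move: (PM) (QM); rewrite ![_ \in link_in _ _]inE => /andP[Pv PU] /andP[Qv QU].
have [_ c2 c3] := cyc P Pv; have [_ c2' _] := cyc Q Qv.
apply/eqP/contraT => xy.
have nPe : ~~ (P \subset e) by apply: contraL eU; exact: c2.
have nQe : ~~ (Q \subset e) by apply: contraL eU; exact: c2'.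
have [PQ|PQ] := eqVneq P Q.
  case/negP: nPe; have /eqP <- : [set x; y] == P.
    by rewrite eqEcard subUset !finset.sub1set xP PQ yQ cards2 xy -PQ (card_link_pair Pv).
  by rewrite subUset !finset.sub1set xe.
have := c3 Q e Qv (disj _ _ PM QM PQ) eH.
rewrite nPe nQe !subUset PU QU eU /=.
have -> : ~~ [disjoint e & P] by apply/pred0Pn; exists x; rewrite /= xe.
have -> : ~~ [disjoint e & Q] by apply/pred0Pn; exists y; rewrite /= ye.
by move/(_ isT).
Qed.

Definition free N S := [set x in N | indep H (x |: S)].

Section Resampling.
Variables U N : {set V}.
Hypothesis NU : N \subset U.
Hypothesis thin : forall e, e \in H -> e \subset U -> {in e :&: N &, forall x y, x = y}.

(** An edge inside [S :|: Y] has at most one vertex in [N], so that the vertices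
    of [N] do not interact. *)
Lemma indep_setU_free S Y : S \in ind (U :\: N) -> Y \subset N ->
  indep H (S :|: Y) = (Y \subset free N S).
Proof.
rewrite inE => /andP[SUN Sind] YN; apply/idP/idP => [SY|Yfree].
  apply/subsetP => x xY; rewrite inE (subsetP YN) //=.
  apply: indepS SY; rewrite subUset finset.subsetUl finset.sub1set inE xY orbT //.
have SU : S \subset U by apply: subset_trans SUN _; exact: finset.subsetDl.
apply/indepP => e eH; apply/negP => eSY.
have eU : e \subset U.
  by apply: subset_trans eSY _; rewrite subUset SU (subset_trans YN).
have [eY|[x]] := finset.set_0Vmem (e :&: Y).
  case/negP: (indepP _ _ Sind e eH); rewrite -(setIidPl eSY) finset.setIUr eY finset.setU0.
  exact: finset.subsetIr.
rewrite inE => /andP[xe xY]; have := subsetP Yfree x xY; rewrite inE => /andP[xN /indepP/(_ e eH)/negP].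
apply; apply/subsetP => y ye; rewrite !inE.
have := subsetP eSY y ye; rewrite inE => /orP[->|yY]; first by rewrite orbT.
by rewrite (thin eH eU (x := y) (y := x)) ?eqxx // inE ?ye ?xe ?(subsetP YN).
Qed.

(** Groups the independent sets by their part outside [N]; within a group the
    trace on [N] is an arbitrary set of free vertices. *)
Lemma sum_ind_resample (F : {set V} -> R) : \sum_(W in ind U) F W =
  \sum_(S in ind (U :\: N)) \sum_(Y : {set V} | Y \subset free N S) F (S :|: Y).
Proof.
rewrite (partition_big (fun W => W :\: N) (mem (ind (U :\: N)))) /=; last first.
  move=> W; rewrite !inE => /andP[WU Wind]; rewrite finset.setSD //=.
  by apply: indepS Wind; exact: finset.subsetDl.
apply: eq_bigr => S Sind; have := Sind; rewrite inE => /andP[SUN _].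
have SN : S :&: N = finset.set0.
  by apply/eqP; rewrite finset.setI_eq0; move: SUN; rewrite subsetD => /andP[].
have SD : S :\: N = S by apply/setDidPl; rewrite -finset.setI_eq0 SN.
rewrite (reindex_onto (fun Y => S :|: Y) (fun W => W :&: N)) /=; last first.
  by move=> W /andP[_ /eqP <-]; rewrite finset.setUC finset.setID.
apply: eq_bigl => Y; rewrite finset.setIUl SN finset.set0U.
have freeN : free N S \subset N by apply/subsetP => x; rewrite inE => /andP[].
apply/idP/idP => [/andP[/andP[]]|Yfree].
  rewrite inE => /andP[_ SYind] _ /eqP/setIidPl YN.
  by rewrite -indep_setU_free.
have YN := subset_trans Yfree freeN.
rewrite (setIidPl YN) eqxx andbT inE indep_setU_free // Yfree andbT.
rewrite finset.setDUl SD; have /eqP -> : Y :\: N == finset.set0 by rewrite finset.setD_eq0.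
rewrite finset.setU0 eqxx andbT subUset (subset_trans YN NU) andbT.
by apply: subset_trans SUN _; exact: finset.subsetDl.
Qed.

End Resampling.

Definition half X (i : V) : R := if i \in X then 2^-1 else 0.

Lemma sum_subsets_half X (F : {set V} -> R) :
  \sum_(Y : {set V} | Y \subset X) F Y = 2 ^+ #|X| * expect (half X) F.
Proof.
rewrite /expect mulr_sumr big_mkcond; apply: eq_bigr => Y _; rewrite mulrA.
case: ifP => [YX|/negbT/subsetPn[i iY iX]]; last first.
  by rewrite /bernw (bigD1 i) //= iY /half (negbTE iX) mul0r mulr0 mul0r.
have -> : bernw (half X) Y = 2^-1 ^+ #|X|.
  rewrite /bernw -prodr_const [RHS]big_mkcond; apply: eq_bigr => i _; rewrite /half.
  case: (boolP (i \in X)) => iX; first by case: ifP => _ //; field.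
  by rewrite ifN ?subr0 //; apply: contra iX; exact: (subsetP YX).
by rewrite -exprMn divff ?expr1n ?mul1r // pnatr_eq0.
Qed.

Lemma indep_add_link v W : v \notin W -> indep H W ->
  indep H (v |: W) = (#|link_in v W| == 0%N).
Proof.
move=> vW Wind; rewrite cards_eq0; apply/idP/eqP => [vWind|l0].
  apply/setP => P; rewrite !inE; apply/negP => /andP[/andP[_ PH] PW].
  by case/negP: (indepP _ _ vWind _ PH); rewrite finset.setUS.
apply/indepP => e eH; apply/negP => evW.
have [ve|ve] := boolP (v \in e); last first.
  by case/negP: (indepP _ _ Wind e eH); rewrite -(setU1K vW) subsetD1 evW ve.
have : e :\ v \in link_in v W.
  by rewrite !inE eqxx setD1K // eH /= subDset.
by rewrite l0 inE.
Qed.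

(** After fixing the part of [W] outside the vertices covered by the link pairs
    in [U], its trace on them is a uniform subset of the free ones.  A pair is then
    contained in [W] with probability x = 1/4 or x = 0, independently for
    different pairs.  The mean number of pairs is the sum of the x, and the
    probability of avoiding all pairs is the product of the 1 - x, which is at
    least the exponential of -4/3 times that sum. *)
Lemma link_tradeoff v U (l : R) : v \notin U -> short_cycles v U = 0%N ->
  3 / 4 * (l * #|ind U|%:R - expR l * #|extensions v U|%:R)
   <= \sum_(W in ind U) #|link_in v W|%:R.
Proof.
move=> vU /no_short_cycles[disj thin]; set N := cover (link_in v U).
have NU : N \subset U by apply/bigcupsP => P; rewrite inE => /andP[].
have -> : #|ind U|%:R = \sum_(W in ind U) 1 :> R by rewrite sumr_const.
have -> : #|extensions v U|%:R = \sum_(W in ind U) (#|link_in v W| == 0%N)%:R :> R.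
  have -> : extensions v U = [set W in ind U | #|link_in v W| == 0%N].
    apply/setP => W; rewrite !inE; apply: andb_id2l => /andP[WU Wind].
    by rewrite indep_add_link //; apply: contra vU; exact: (subsetP WU).
  rewrite -sum1dep_card natr_sum big_mkcondr; apply: eq_bigr => W _.
  by case: (_ == _).
rewrite !(sum_ind_resample NU thin) !mulr_sumr -sumrB mulr_sumr.
apply: ler_sum => S Sind; set X := free N S.
have XN : X \subset N by apply/subsetP => x; rewrite inE => /andP[].
move: Sind; rewrite inE => /andP[SUN _].
have SU : S \subset U by apply: subset_trans SUN _; exact: finset.subsetDl.
have SN : S :&: N = finset.set0.
  by apply/eqP; rewrite finset.setI_eq0; move: SUN; rewrite subsetD => /andP[].
set M := link_in v U.
have linkE Y : Y \subset X -> link_in v (S :|: Y) = [set P in M | P \subset Y].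
  move=> YX; have YN := subset_trans YX XN; have YU := subset_trans YN NU.
  apply/setP => P; rewrite !inE -!andbA; apply: andb_id2l => vP; apply: andb_id2l => PH.
  apply/idP/andP => [PSY|[_ PY]]; last by apply: subset_trans PY _; exact: finset.subsetUr.
  have PU : P \subset U by apply: subset_trans PSY _; rewrite subUset SU.
  have PN : P \subset N by apply: (bigcup_sup P); rewrite // !inE vP PH.
  split=> //; rewrite -(setIidPl PN); apply: subset_trans (finset.setSI N PSY) _.
  by rewrite finset.setIUl SN finset.set0U finset.subsetIl.
pose x P := expect (half X) (fun Y => (P \subset Y)%:R).
have E0 : \sum_(Y : {set V} | Y \subset X) (#|link_in v (S :|: Y)| == 0%N)%:R
    = 2 ^+ #|X| * \prod_(P in M) (1 - x P).
  transitivity (\sum_(Y : {set V} | Y \subset X) \prod_(P <- enum M) (1 - (P \subset Y)%:R) : R).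
    apply: eq_bigr => Y YX; rewrite linkE // big_enum /= cards_eq0.
    case: (finset.set_0Vmem [set P in M | P \subset Y]) => [e0|[P]].
      rewrite e0 eqxx big1 // => P PM; have : P \in [set P in M | P \subset Y] = false by rewrite e0 inE.
      by rewrite inE PM /= => ->; rewrite subr0.
    move=> PMY; rewrite (negbTE (_ : _ != _)); last by apply/finset.set0Pn; exists P.
    by move: PMY; rewrite inE => /andP[PM PY]; rewrite (bigD1 P) //= PY subrr mul0r.
  rewrite sum_subsets_half (@expect_prod _ _ _ _ _ id) ?enum_uniq //.
  - rewrite big_enum; congr (_ * _); apply: eq_bigr => P _.
    rewrite (eq_expect _ (G := fun Y => 1 + -1 * (P \subset Y)%:R)).
      by rewrite expectD expect1 expectZ mulN1r.
    by move=> Y; rewrite mulN1r.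
  - by move=> P Q; rewrite !mem_enum; exact: disj.
  - by move=> P Y; rewrite subsetI subxx andbT.
have E1 : \sum_(Y : {set V} | Y \subset X) #|link_in v (S :|: Y)|%:R
    = 2 ^+ #|X| * \sum_(P in M) x P.
  rewrite -expect_sum -sum_subsets_half; apply: eq_bigr => Y YX.
  rewrite linkE // -sum1_card natr_sum [RHS]big_mkcond [LHS]big_mkcond.
  by apply: eq_bigr => P _; rewrite inE; case: (P \in M); case: (P \subset Y).
rewrite E0 E1 sum_subsets_half expect1 mulr1.
have factor (c q : R) :
    3 / 4 * (l * c - expR l * (c * q)) = c * (3 / 4 * (l - expR l * q)) by ring.
rewrite factor; clear factor.
rewrite ler_wpM2l ?exprn_ge0 //.
have x14 P : P \in M -> x P = 0 \/ x P = 1 / 4.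
  rewrite inE => /andP[/card_link_pair P2 _]; rewrite /x expect_sub.
  have [PX|/subsetPn[i iP iX]] := boolP (P \subset X); [right|left].
    rewrite (eq_bigr (fun=> 2^-1)); first by rewrite prodr_const P2; field.
    by move=> i iP; rewrite /half (subsetP PX).
  by rewrite (bigD1 i) //= /half (negbTE iX) mul0r.
have prod_ge : expR (- (4 / 3 * \sum_(P in M) x P)) <= \prod_(P in M) (1 - x P).
  rewrite mulr_sumr -sumrN expR_sum; apply: ler_prod => P PM; rewrite expR_ge0 /= -/(x P).
  case: (x14 P PM) => ->.
    by rewrite mulr0 oppr0 expR0 addr0.
  by rewrite (_ : 4 / 3 * (1 / 4) = 1 / 3) ?expR_third_le //; field.
exact: tangent_bound.
Qed.

Lemma card_ind_with v U : v \in U ->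
  #|[set W in ind U | v \in W]| = #|extensions v (U :\ v)|.
Proof.
move=> vU; rewrite -[RHS](card_in_imset (f := fun W => v |: W)); last first.
  move=> W W'; rewrite !inE => /andP[/andP[]] + _ _ /andP[/andP[]] + _ _.
  rewrite !subsetD1 => /andP[_ vW] /andP[_ vW'] WW'.
  by rewrite -(setU1K vW) WW' setU1K.
apply: eq_card => W; apply/idP/imsetP => [|[W' + ->]]; rewrite !inE.
  case/andP=> /andP[WU Wind] vW; exists (W :\ v); last by rewrite setD1K.
  rewrite !inE setD1K // Wind andbT finset.setSD //=.
  by apply: indepS Wind; exact: finset.subsetDl.
rewrite subsetD1 => /andP[/andP[/andP[W'U vW'] _] ->].
by rewrite eqxx subUset finset.sub1set vU W'U.
Qed.

Lemma card_ind_split v U : v \in U ->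
  #|ind U| = (#|ind (U :\ v)| + #|extensions v (U :\ v)|)%N.
Proof.
move=> vU; rewrite -card_ind_with // -(finset.cardsID [set W : {set V} | v \in W] (ind U)) addnC.
congr (_ + _)%N; apply: eq_card => W; rewrite !inE // subsetD1.
by case: (v \in W); rewrite ?andbF ?andbT.
Qed.

Definition extension_ratio v U : R := #|extensions v U|%:R / #|ind U|%:R.
Definition mean_links v U : R := (\sum_(W in ind U) #|link_in v W|%:R) / #|ind U|%:R.

Variable t : nat.
Hypothesis ind_le_t : forall W, indep H W -> (#|W| <= t)%N.

Let card_ind_gt0R U : 0 < #|ind U|%:R :> R.
Proof. by rewrite ltr0n card_ind_gt0. Qed.

(** The independent subsets of [U] that contain [v] correspond to the
    extensions by [v] of independent subsets of [U :\ v].  Extending at most doubles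
    the number of sets, so that the ratio is at most twice the probability that
    the random independent set contains [v]. *)
Lemma sum_extension_ratio U : \sum_(v in U) extension_ratio v (U :\ v) <= 2 * t%:R.
Proof.
(* As b <= a, the ratio b / a is at most 2 b / (a + b). *)
apply: (@le_trans _ _ (\sum_(v in U) 2 * (#|[set W in ind U | v \in W]|%:R / #|ind U|%:R))).
  apply: ler_sum => v vU; rewrite card_ind_with // (card_ind_split vU) natrD.
  rewrite /extension_ratio; set a := #|ind _|%:R; set b := #|extensions _ _|%:R.
  have a0 : 0 < a by exact: card_ind_gt0R.
  have b0 : 0 <= b by rewrite ler0n.
  have ba : b <= a by rewrite ler_nat subset_leq_card //; apply/subsetP => W; rewrite inE => /andP[].
  rewrite ler_pdivrMr // mulrA mulrAC ler_pdivlMr ?ltr_wpDr //.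
  by have := mulr_ge0 b0 (ltW a0); nra.
rewrite -mulr_sumr ler_wpM2l // -mulr_suml ler_pdivrMr // -natr_sum.
have -> : (\sum_(v in U) #|[set W in ind U | v \in W]| = \sum_(W in ind U) #|W|)%N.
  transitivity (\sum_(v in U) \sum_(W in ind U) (v \in W))%N.
    apply: eq_bigr => v _; rewrite -big_mkcondr sum1_card.
    by apply: eq_card => W; rewrite inE.
  rewrite exchange_big; apply: eq_bigr => W; rewrite inE => /andP[WU _].
  rewrite -big_mkcondr sum1_card; apply: eq_card => v.
  apply/andP/idP => [[]//|vW]; split => //; exact: (subsetP WU).
rewrite -natrM ler_nat mulnC -sum_nat_const leq_sum // => W.
by rewrite inE => /andP[_ /ind_le_t].
Qed.

(** This holds for each independent [W] separately, by [sum_link_in]. *)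
Lemma sum_mean_links U : \sum_v mean_links v U <= lambda%:R * t%:R ^+ 2 / 2.
Proof.
rewrite -mulr_suml ler_pdivrMr // exchange_big /=.
apply: (@le_trans _ _ (\sum_(W in ind U) (lambda%:R * t%:R ^+ 2 / 2))); last first.
  by rewrite sumr_const mulr_natr.
apply: ler_sum => W; rewrite inE => /andP[_ /ind_le_t Wt].
rewrite -natr_sum; apply: (@le_trans _ _ (lambda * 'C(t, 2))%:R).
  by rewrite ler_nat (leq_trans (sum_link_in W)) // leq_mul2l leq_bin2l ?orbT.
rewrite natrM -mulrA ler_wpM2l // ler_pdivlMr // -natrX -natrM ler_nat bin2.
apply: (@leq_trans (t * t.-1)); last by rewrite -mulnn leq_mul2l leq_pred orbT.
by rewrite -[X in (_ <= X)%N]odd_double_half muln2 leq_addl.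
Qed.

(** A short cycle makes the left-hand side nonpositive, so that the trade-off
    can be averaged over all samples. *)
Lemma mean_links_ge v U l : v \notin U -> 0 <= l ->
  3 / 4 * (l * (1 - (short_cycles v U)%:R) - expR l * extension_ratio v U) <= mean_links v U.
Proof.
move=> vU l0; have f0 : 0 <= expR l * extension_ratio v U.
  by rewrite mulr_ge0 ?expR_ge0 // divr_ge0.
have [cyc0|cyc] := posnP (short_cycles v U); last first.
  apply: (@le_trans _ _ 0); last by rewrite divr_ge0 // sumr_ge0.
  rewrite pmulr_rle0 // subr_le0; apply: le_trans f0.
  by rewrite mulr_ge0_le0 // subr_le0 (ler_nat _ 1).
rewrite cyc0 subr0 mulr1 /mean_links ler_pdivlMr //.
apply: le_trans (link_tradeoff l vU cyc0).
have fa : extension_ratio v U * #|ind U|%:R = #|extensions v U|%:R.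
  by rewrite /extension_ratio divfK // gt_eqF.
by rewrite -fa; move: (extension_ratio v U) (#|ind U|%:R) (expR l) => f a b; lra.
Qed.

Section Averaging.
Variable rho : R.
Hypothesis rho01 : 0 < rho <= 1.
Let E := expect (fun _ : V => rho).

Lemma expect_in v (F : {set V} -> R) :
  E (fun U => (v \in U)%:R * F (U :\ v)) = rho * E (fun U => F (U :\ v)).
Proof.
rewrite /E (@expectM _ _ _ [set v] (~: [set v]) (fun U => (v \in U)%:R) (fun U => F (U :\ v))).
- congr (_ * _); transitivity (E (fun U => ([set v] \subset U)%:R)).
    by apply: eq_expect => U; rewrite finset.sub1set.
  by rewrite /E expect_sub prodr_const cards1 expr1.
- by rewrite -finset.setI_eq0 finset.setICr.
- by move=> U; rewrite !inE eqxx andbT.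
- by move=> U; rewrite -!finset.setDE finset.setDDl finset.setUid.
Qed.

(** With [expect_in] this moves between a sample that avoids [v] and the same
    sample with [v] removed, so that extensions and links at [v] are averaged over
    the same sets. *)
Lemma expect_notin v (F : {set V} -> R) :
  E (fun U => (v \notin U)%:R * F U) = (1 - rho) * E (fun U => F (U :\ v)).
Proof.
rewrite mulrBl mul1r -expect_in -mulN1r -expectZ -expectD.
apply: eq_expect => U; case: (boolP (v \in U)) => vU /=; first by rewrite mul0r mul1r mulN1r subrr.
by rewrite mul1r mul0r mulr0 addr0 (setDidPl _) // disjoint_sym disjoints1.
Qed.

(** The average over the samples of [mean_links_ge], summed over all vertices. *)
Lemma independence_bound l : 0 <= l ->
  (1 - rho) * (3 / 4 * (l * (#|V|%:R * (1 - (#|V| * lambda)%:R *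
      ((2 * lambda)%:R * rho ^+ 3 + lambda%:R * rho ^+ 3
       + (#|V| * lambda)%:R * ((4 * lambda)%:R * rho ^+ 5))))
    - expR l * (2 * t%:R / rho))) <= lambda%:R * t%:R ^+ 2 / 2.
Proof.
move=> l0; have /andP[r0 r1] := rho01; set kappa := (_ * _)%:R * (_ + _).
have r01 : 0 <= rho <= 1 by rewrite ltW.
have ratio : \sum_v E (fun U => extension_ratio v (U :\ v)) <= 2 * t%:R / rho.
  rewrite ler_pdivlMr // mulrC mulr_sumr.
  under eq_bigr do rewrite -expect_in.
  rewrite -expect_sum -[leRHS](@expect_cst _ _ (fun _ : V => rho)).
  apply: le_expect => // U; apply: le_trans (sum_extension_ratio U).
  by rewrite [leRHS]big_mkcond; apply: ler_sum => v _; case: (v \in U); rewrite /= ?mul1r ?mul0r.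
have links : (1 - rho) * \sum_v E (fun U => mean_links v (U :\ v)) <= lambda%:R * t%:R ^+ 2 / 2.
  rewrite mulr_sumr; under eq_bigr do rewrite -expect_notin.
  rewrite -expect_sum -[leRHS](@expect_cst _ _ (fun _ : V => rho)).
  apply: le_expect => // U; apply: le_trans (sum_mean_links U).
  apply: ler_sum => v _; have : 0 <= mean_links v U by rewrite divr_ge0 ?sumr_ge0.
  by case: (v \in U); rewrite /= ?mul1r ?mul0r.
apply: le_trans links; rewrite ler_wpM2l ?subr_ge0 //.
apply: (@le_trans _ _ (\sum_v 3 / 4 * (l * (1 - kappa) - expR l * E (fun U => extension_ratio v (U :\ v))))).
  rewrite -mulr_sumr ler_wpM2l // sumrB; apply: lerD.
    by rewrite sumr_const -[leRHS]mulr_natl mulrCA.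
  by rewrite -mulr_sumr lerN2 ler_wpM2l ?expR_ge0.
apply: ler_sum => v _.
apply: (@le_trans _ _ (E (fun U => 3 / 4 * (l * (1 + -1 * (short_cycles v (U :\ v))%:R)
    + - expR l * extension_ratio v (U :\ v))))); last first.
  apply: le_expect => // U; rewrite mulN1r mulNr; apply: mean_links_ge => //.
  by rewrite !inE eqxx.
rewrite /E expectZ expectD expectZ expectD expect1 !expectZ mulN1r [- expR l * _]mulNr ler_wpM2l //.
by rewrite lerD2r ler_wpM2l // lerD2l lerN2 expect_short_cycles.
Qed.

End Averaging.

End IndependentSets.

(** * The upper bound *)
Section UpperBound.
Variable R : realType.

(** With m = e^{40 x}, the density of the sample is m^{-18/40} / lambda and the
    threshold is l = x.  Short cycles then have expectation at most
    3 e^{-14 x} + 4 e^{-10 x} per vertex, and the error term 2 t e^l / rho is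
    2 t lambda m^{19/40}, which is negligible when t exceeds m^{19/40}; a smaller t
    contradicts the inequality, whose main term is x m / 2. *)
Lemma independence_number_bound (V : finType) (H : {set {set V}}) (lambda t : nat) (x : R) :
    H \subset triples V -> codeg_le lambda H ->
    (forall W : {set V}, indep H W -> (#|W| <= t)%N) ->
    (0 < lambda)%N -> 3 <= x -> #|V|%:R = lambda%:R * expR (40 * x) ->
  3 / 20 * x * expR (40 * x) <= t%:R ^+ 2.
Proof.
move=> H3 Hcodeg Hind l0 x3 nE.
have l0R : 0 < lambda%:R :> R by rewrite ltr0n.
set G := expR (- (18 * x)); set rho : R := G / lambda%:R.
have rho0 : 0 < rho by rewrite divr_gt0 ?expR_gt0.
have rho2 : rho <= 1 / 2.
  apply: (@le_trans _ _ G).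
    rewrite ler_pdivrMr // ler_peMr ?expR_ge0 // (ler_nat _ 1) //.
  by apply: expR_le_inv; lra.
have rho01 : 0 < rho <= 1 by rewrite rho0 (le_trans rho2) //; lra.
have x0 : 0 <= x by lra.
have := independence_bound H3 Hcodeg Hind rho01 x0.
set M := expR (40 * x) in nE *.
set P := expR (19 * x); set Q := expR (2 * x).
have G0 : 0 < G by exact: expR_gt0.
have P0 : 0 < P by exact: expR_gt0.
have M0 : 0 < M by exact: expR_gt0.
have MG3 : M * G ^+ 3 <= 1 / 31.
  rewrite /M /G -expRM_natl -expRD; apply: (@le_trans _ _ (expR (- (10 * x)))).
    by rewrite ler_expR; lra.
  by apply: expR_le_inv; lra.
have MG5 : M ^+ 2 * G ^+ 5 <= 1 / 31.
  rewrite /M /G -!expRM_natl -expRD; apply: (@le_trans _ _ (expR (- (10 * x)))).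
    by rewrite ler_expR; lra.
  by apply: expR_le_inv; lra.
have MPQ : M = P ^+ 2 * Q by rewrite /M /P /Q -expRM_natl -expRD; congr expR; ring.
have EP : expR x * (2 * t%:R / rho) = lambda%:R * (2 * t%:R * P).
  have -> : P = expR x * G^-1 by rewrite /P /G -expRN -expRD; congr expR; ring.
  by rewrite /rho; field; rewrite !gt_eqF.
rewrite EP !natrM nE.
have -> : lambda%:R * M * lambda%:R * (2 * lambda%:R * rho ^+ 3 + lambda%:R * rho ^+ 3
    + lambda%:R * M * lambda%:R * (4 * lambda%:R * rho ^+ 5))
  = 3 * (M * G ^+ 3) + 4 * (M ^+ 2 * G ^+ 5).
  by rewrite /rho; field; rewrite gt_eqF.
set k := 3 * _ + _; have k2 : k <= 1 / 2 by rewrite /k; lra.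
have -> : (1 - rho) * (3 / 4 * (x * (lambda%:R * M * (1 - k)) - lambda%:R * (2 * t%:R * P)))
  = lambda%:R * ((1 - rho) * (3 / 4 * (x * (M * (1 - k)) - 2 * t%:R * P))) by ring.
rewrite -[lambda%:R * t%:R ^+ 2 / 2]mulrA ler_pM2l // => main.
have t0 : 0 <= t%:R :> R by [].
have xM0 : 0 < x * M by rewrite mulr_gt0 //; lra.
have half_main : 3 / 8 * (x * M / 2 - 2 * t%:R * P) <= t%:R ^+ 2 / 2.
  set B := x * M / 2 - 2 * t%:R * P.
  have BB : B <= x * (M * (1 - k)) - 2 * t%:R * P.
    by rewrite /B; have := ler_wpM2l (ltW xM0) k2; lra.
  (* For negative [B] the factor [1 - rho] goes the wrong way, but then nothing is claimed. *)
  have [B0|B0] := leP B 0; first by have := sqr_ge0 (t%:R : R); lra.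
  apply: le_trans main; have rhoB : rho * B <= 1 / 2 * B by rewrite ler_wpM2r // ltW.
  have := ler_wpM2l (_ : 0 <= 1 - rho) BB; rewrite subr_ge0 (ltW (le_lt_trans rho2 _)); last by lra.
  by move=> /(_ isT); lra.
have xQ : 21 <= x * Q.
  have Q7 : 7 <= Q by apply: le_trans (expR_ge1Dx _); lra.
  by have := ler_pM (ler0n _ 3) (ler0n _ 7) x3 Q7; lra.
have xM21 : 21 * P ^+ 2 <= x * M.
  by rewrite MPQ; have := ler_wpM2r (sqr_ge0 P) xQ; lra.
(* Either the error term 2 t P is absorbed by t^2, or t^2 is smaller than P^2,
   which the main term exceeds by the factor Q. *)
have [tP|tP] := leP t%:R P; last first.
  have : t%:R * P <= t%:R ^+ 2 by rewrite expr2 ler_wpM2l // ltW.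
  by lra.
have t2P : t%:R ^+ 2 <= P ^+ 2 by rewrite lerXn2r // nnegrE // ltW.
have tPP : t%:R * P <= P ^+ 2 by rewrite expr2 ler_wpM2r // ltW.
have : 0 < P ^+ 2 by rewrite exprn_gt0.
lra.
Qed.

Lemma arrow_of_independence (n lambda t : nat) (x : R) :
    (0 < lambda)%N -> 3 <= x -> n%:R = lambda%:R * expR (40 * x) ->
    t%:R ^+ 2 < 3 / 20 * x * expR (40 * x) ->
  ramsey_arrow n (book3 lambda) (complete3 t).
Proof.
move=> l0 x3 nE tx chi.
have [codeg|] := boolP (codeg_le lambda (red chi)); last by move/book_copyP; left.
right; apply/complete_copyP; apply: contrapT => none.
suff : 3 / 20 * x * expR (40 * x) <= t%:R ^+ 2 by rewrite leNgt tx.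
apply: (independence_number_bound (red_triples chi) codeg) => //; last by rewrite card_ord.
move=> W Wind; rewrite leqNgt; apply/negP => tW; apply: none.
have : (0 < #|[set S : {set 'I_n} | (S \subset W) && (#|S| == t)]|)%N.
  by rewrite cards_draws bin_gt0 ltnW.
case/card_gt0P => S; rewrite inE => /andP[SW /eqP St]; exists S; split=> //.
exact: indepS SW Wind.
Qed.

End UpperBound.

(** As ln (ln y) <= ln y, the factor (ln y)^{- eps} is at least y^{- eps}. *)
Lemma expR_mul_ln_le (R : realType) (c eps y T : R) : 3 <= y ->
    y `^ (2 * eps) * ln y `^ (1 - eps) <= c * T -> 0 < eps ->
  expR (eps * ln y) * ln y <= c * T.
Proof.
move=> y3 hyp e0; apply: le_trans hyp.
have y0 : 0 < y by lra.
have L1 : 1 <= ln y by apply/ln_ge_of_expR/(le_trans (expR1_le3 R)).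
have L0 : 0 < ln y by lra.
rewrite /powR !gt_eqF // -[X in _ * X <= _](lnK (L0 : ln y \in Num.pos)) -!expRD ler_expR.
by have := ln_sublinear L0; have := ltW e0; nra.
Qed.

Theorem theorem1p8 (R : realType) (c eps : R) (hc : 0 < c) (heps : 0 < eps) :
  exists c2 : R, 1 / 96 <= c2 /\
    forall t lambda : nat, (3 <= t)%N -> (1 <= lambda)%N ->
      (lambda * t)%:R `^ (2 * eps) * ln ((lambda * t)%:R : R) `^ (1 - eps)
        <= c * t%:R ^+ 2 ->
      exists N : nat, is_ramsey_number (book3 lambda) (complete3 t) N /\
        lambda%:R * t%:R ^+ 2 / (96 * ln ((lambda * t)%:R : R)) <= N%:R /\
        N%:R <= c2 * lambda%:R * t%:R ^+ 2 / ln ((lambda * t)%:R : R).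
Proof.
(* [A] makes ln m at least 120, as [independence_number_bound] asks with
   x = ln m / 40; [B] makes m ln m large compared with t^2. *)
pose A := 2 * c * expR 120; pose B := 80 * 20 / eps; pose c2 := 1 / 96 + A + B.
have A0 : 0 < A by rewrite !mulr_gt0 ?expR_gt0.
have B0 : 0 < B by rewrite !mulr_gt0 ?invr_gt0.
have c2ge : 1 / 96 <= c2 by rewrite /c2 -addrA lerDl addr_ge0 // ltW.
have Ac2 : A <= c2 by rewrite /c2 addrAC lerDr addr_ge0 // ltW.
have Bc2 : 80 * 20 <= eps * c2.
  have -> : 80 * 20 = eps * B by rewrite /B [RHS]mulrC divfK ?gt_eqF.
  by rewrite ler_wpM2l ?(ltW heps) // /c2 lerDr addr_ge0 // ltW.
exists c2; split=> // t lambda t3 l0 hyp; clearbody c2.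
have l0R : 0 < lambda%:R :> R by rewrite ltr0n.
have T0 : 0 < t%:R :> R by rewrite ltr0n (leq_trans _ t3).
have y3 : 3 <= (lambda * t)%:R :> R.
  by rewrite (ler_nat _ 3) (leq_trans t3) // leq_pmull.
have := expR_mul_ln_le y3 hyp heps.
set L := ln (lambda * t)%:R => expL.
have L1 : 1 <= L by apply/ln_ge_of_expR/(le_trans (expR1_le3 R)).
have L0 : 0 < L by exact: lt_le_trans L1.
have epsL : 0 < eps * L by rewrite mulr_gt0.
pose w := t%:R ^+ 2 / L.
have w0 : 0 < w by rewrite divr_gt0 ?exprn_gt0.
have wL : w * L = t%:R ^+ 2 by rewrite /w divfK ?gt_eqF.
pose z := c2 * w * lambda%:R.
have zE : c2 * lambda%:R * t%:R ^+ 2 / L = z by rewrite /z -mulrA mulrAC.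
have zl : 2 * expR (120 + eps * L) <= c2 * w.
  apply: (@le_trans _ _ (A * w)); last by rewrite ler_wpM2r // ltW.
  rewrite /A expRD -!mulrA ler_pM2l // [leRHS]mulrCA ler_pM2l ?expR_gt0 //.
  by rewrite /w mulrA ler_pdivlMr.
have z1 : 1 <= z.
  rewrite /z -[leLHS]mulr1 ler_pM // ?(ler_nat _ 1) //; apply: le_trans zl.
  have : 1 <= expR (120 + eps * L) by rewrite -expR0 ler_expR addr_ge0 // ltW.
  by move=> h; apply: le_trans h _; rewrite ler_peMl ?expR_ge0 // (ler_nat _ 1).
(* [z] is the claimed upper bound; rounding down loses at most a factor 2. *)
pose n := Num.truncn z.
have nz : n%:R <= z by rewrite truncn_le (le_trans _ z1).
have zn : z <= 2 * n%:R.
  have n1 : 1 <= n%:R :> R by rewrite (ler_nat _ 1) truncn_ge_nat ?(le_trans _ z1).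
  have := truncnS_gt z; rewrite -/n -natr1; move: n1; clear; lra.
have n0 : 0 < n%:R :> R by move: z1 zn; clear; lra.
pose m := n%:R / lambda%:R : R.
have m0 : 0 < m by rewrite divr_gt0.
have mw : c2 * w / 2 <= m.
  rewrite /m ler_pdivlMr //; move: zn; rewrite /z; clear; lra.
have mexp : expR (120 + eps * L) <= m.
  by apply: le_trans mw; move: zl; clear; lra.
have lnm := ln_ge_of_expR mexp.
pose x := ln m / 40.
have x3 : 3 <= x by rewrite /x ler_pdivlMr //; move: lnm epsL; clear; lra.
have xL : eps * L / 40 <= x by rewrite /x ler_pM2r ?invr_gt0 //; move: lnm; clear; lra.
have xm : expR (40 * x) = m by rewrite /x mulrC divfK ?lnK // pnatr_eq0.
have nE : n%:R = lambda%:R * expR (40 * x) by rewrite xm /m mulrC divfK ?gt_eqF.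
have arrow : ramsey_arrow n (book3 lambda) (complete3 t).
  apply: (arrow_of_independence l0 x3 nE); rewrite xm.
  have : 20 * t%:R ^+ 2 <= x * m.
    apply: (@le_trans _ _ ((eps * L / 40) * (c2 * w / 2))).
      have -> : eps * L / 40 * (c2 * w / 2) = (eps * c2) * (w * L) / 80 by field.
      by rewrite wL; have := ler_wpM2r (sqr_ge0 (t%:R : R)) Bc2; clear; lra.
    apply: ler_pM => //; first by rewrite ltW // divr_gt0.
    by rewrite ltW // divr_gt0 // mulr_gt0 //; move: Bc2; rewrite -(pmulr_rgt0 _ heps); clear; lra.
  have : 0 < t%:R ^+ 2 :> R by rewrite exprn_gt0.
  clear; lra.
have ex : exists N, `[< ramsey_arrow N (book3 lambda) (complete3 t) >].
  by exists n; apply/asboolP.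
case: (ex_minnP ex) => N /asboolP arrowN minN.
exists N; split; first by split=> // M /asboolP/minN.
split; first exact: ramsey_lower.
by rewrite zE; apply: le_trans nz; rewrite ler_nat; apply/minN/asboolP.
Qed.
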